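(* Let $K$ be a compact space and let $m$ be a positive integer or $\infty$. The following are equivalent: (1) $\mathcal{C}(K)$ admits a bump function of class $\mathcal{C}^m$; (2) $\mathcal{C}(K)$ admits a Talagrand operator of class $\mathcal{C}^m$; (3) $\mathcal{C}(K)$ admits partitions of unity of class $\mathcal{C}^m$.
   Context: Compact spaces are Hausdorff. $\mathcal{C}(K)$ is the Banach space of continuous real-valued functions on $K$ with the supremum norm $\|\cdot\|_\infty$; smoothness is in the Fréchet sense. A bump function on a Banach space $X$ is a function $\beta:X\to\mathbb{R}$ which is not identically zero, but which vanishes outside some bounded set. A (non-linear) Talagrand operator of class $\mathcal{C}^m$ on $\mathcal{C}(K)$ is a mapping $T:\mathcal{C}(K)\to c_0(K\times\Gamma)$, for some set $\Gamma$, such that: (i) for each non-zero $f\in\mathcal{C}(K)$ there exist $t\in K$, $u\in\Gamma$ such that $|f(t)|=\|f\|_\infty$ and $(Tf)(t,u)\neq 0$; (ii) each coordinate function $f\mapsto (Tf)(t,u)$ is of class $\mathcal{C}^m$ on the set where it is not zero. Here $c_0(K\times\Gamma)$ is the space of functions $x:K\times\Gamma\to\mathbb{R}$ such that $\{(t,u):|x(t,u)|\ge\epsilon\}$ is finite for each $\epsilon>0$, with the supremum norm ($K\times\Gamma$ is regarded as a set without topology). A Banach space $X$ admits partitions of unity of class $\mathcal{C}^m$ if for every open cover of $X$ there is a locally finite partition of unity on $X$, consisting of functions of class $\mathcal{C}^m$, subordinate to that cover.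
   Formalization: The Talagrand operator T: C(K) → c_0(K×Γ) is additionally required to be continuous for the norms; without this the set where a coordinate is non-zero need not be open, and singleton non-zero sets give (2) for K=[0,1], where (1) fails. *)

(* Defs.v *)
From HB Require Import structures.
From mathcomp Require Import all_boot all_order all_algebra.
From mathcomp Require Import all_classical all_reals all_analysis.

Set Implicit Arguments.
Unset Strict Implicit.
Unset Printing Implicit Defensive.

Import Order.TTheory GRing.Theory Num.Theory.
Import numFieldNormedType.Exports.

Local Open Scope classical_set_scope.
Local Open Scope ring_scope.

Section SupNorm.
Context {R : realType} {I : Type} {W : normedModType R}.
Implicit Types (A : set I) (f g : I -> W).

(* [sup set0 = 0], so the supremum over an empty [A] is 0, as it should be. *)
Definition supnorm A f : R := sup [set `|f i| | i in A].

Definition bounded_on A f := exists M : R, forall i, A i -> `|f i| <= M.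

Lemma supnorm_ub A f i : bounded_on A f -> A i -> `|f i| <= supnorm A f.
Proof.
move=> [M fM] Ai; apply: ub_le_sup; last by exists i.
by exists M => _ [j Aj <-]; exact: fM.
Qed.

Lemma supnorm_le A f (M : R) : 0 <= M -> (forall i, A i -> `|f i| <= M) ->
  supnorm A f <= M.
Proof.
move=> M0 fM; rewrite /supnorm; set B := [set _ | _ in _].
have [->|/set0P B0] := eqVneq B set0; first by rewrite sup0.
by apply: ge_sup => // _ [j Aj <-]; exact: fM.
Qed.

Lemma supnorm_ge0 A f : bounded_on A f -> 0 <= supnorm A f.
Proof.
move=> fb; have [A0|/set0P[i Ai]] := eqVneq A set0.
  by rewrite /supnorm A0 image_set0 sup0.
exact: le_trans (supnorm_ub fb Ai).
Qed.

Lemma supnormD A f g : bounded_on A f -> bounded_on A g ->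
  supnorm A (f + g) <= supnorm A f + supnorm A g.
Proof.
move=> fb gb; apply: supnorm_le; first by rewrite addr_ge0 ?supnorm_ge0.
move=> i Ai; apply: le_trans (ler_normD _ _) _.
by rewrite lerD// supnorm_ub.
Qed.

Lemma supnormZ A f (l : R) : bounded_on A f ->
  supnorm A (l *: f) = `|l| * supnorm A f.
Proof.
move=> fb; apply/eqP; rewrite eq_le; apply/andP; split.
  apply: supnorm_le; first by rewrite mulr_ge0 ?supnorm_ge0.
  by move=> i Ai; rewrite [X in `|X|]/(l *: f i) normrZ ler_wpM2l// supnorm_ub.
have lfb : bounded_on A (l *: f).
  have [M fM] := fb; exists (`|l| * M) => i Ai.
  by rewrite [X in `|X|]/(l *: f i) normrZ ler_wpM2l// fM.
have [->|l0] := eqVneq l 0; first by rewrite normr0 mul0r scale0r supnorm_ge0 //; exists 0 => i _; rewrite normr0.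
rewrite -ler_pdivlMl ?normr_gt0//; apply: supnorm_le.
  by rewrite mulr_ge0 ?invr_ge0 ?supnorm_ge0.
by move=> i Ai; rewrite ler_pdivlMl ?normr_gt0// -normrZ; exact: (supnorm_ub lfb Ai).
Qed.

Lemma supnorm0_eq0 A f i : bounded_on A f -> supnorm A f = 0 -> A i -> f i = 0.
Proof.
move=> fb f0 Ai; apply/eqP; rewrite -normr_le0 -f0; exact: supnorm_ub.
Qed.

End SupNorm.

Section ContinuousFunctions.
Context (R : realType) (K : topologicalType).

Definition cts_pred : {pred K -> R} := mem [set f : K -> R | continuous f].

(* The compactness proof is a phantom parameter: it is what makes the
   supremum norm a norm on the whole type. *)
Record Cfun (cptK : compact [set: K]) :=
  MkCfun { cfun_val :> K -> R ; cfun_in : cfun_val \in cts_pred }.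

Lemma cts_submod_closed : submod_closed cts_pred.
Proof.
split; first by rewrite inE => x; exact: cvg_cst.
move=> a f g; rewrite !inE => cf cg x.
by apply: cvgD; [apply: cvgZ; [exact: cvg_cst|exact: cf]|exact: cg].
Qed.

HB.instance Definition _ := GRing.isSubmodClosed.Build _ _ cts_pred
  cts_submod_closed.

Context (cptK : compact [set: K]).
HB.instance Definition _ := [isSub for @cfun_val cptK].
HB.instance Definition _ := [Choice of Cfun cptK by <:].
HB.instance Definition _ := [SubChoice_isSubLmodule of Cfun cptK by <:].

Lemma cfun_continuous (f : Cfun cptK) : continuous f.
Proof. by have := cfun_in f; rewrite inE. Qed.

Lemma cfun_bounded (f : Cfun cptK) : bounded_on [set: K] f.
Proof.
have fcpt : compact (f @` [set: K]).
  apply: continuous_compact cptK.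
  by apply: continuous_subspaceT => x; exact: cfun_continuous.
have [M [_ fM]] := compact_bounded fcpt.
by exists (M + 1) => x _; apply: (fM (M + 1)); rewrite ?ltrDl//; exists x.
Qed.

Let norm (f : Cfun cptK) : R := supnorm [set: K] f.

Let normD f g : norm (f + g) <= norm f + norm g.
Proof. by apply: supnormD; exact: cfun_bounded. Qed.

Let normZ (l : R) f : norm (l *: f) = `|l| * norm f.
Proof. by apply: supnormZ; exact: cfun_bounded. Qed.

Let norm_eq0 f : norm f = 0 -> f = 0.
Proof.
move=> f0; apply/val_inj/funext => x.
exact: (supnorm0_eq0 (cfun_bounded f) f0).
Qed.

HB.instance Definition _ :=
  Lmodule_isNormed.Build R (Cfun cptK) normD normZ norm_eq0.

Lemma cfun_normE (f : Cfun cptK) : `|f| = supnorm [set: K] f.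
Proof. by []. Qed.

End ContinuousFunctions.

Section C0.
Context (R : realType) (I : Type).

Definition c0_pred : {pred I -> R} :=
  mem [set x : I -> R | forall e, 0 < e -> finite_set [set i | e <= `|x i|]].

Record c0 := MkC0 { c0_val :> I -> R ; c0_in : c0_val \in c0_pred }.

Lemma c0_submod_closed : submod_closed c0_pred.
Proof.
split.
  rewrite inE => e e0 /=.
  rewrite (_ : [set _ | _] = set0)//; apply/seteqP; split => // i /=.
  by rewrite normr0 leNgt e0.
move=> a x y; rewrite !inE => x0 y0 e e0 /=.
have a0 : 0 < `|a| + 1 by rewrite ltr_wpDl.
have e2 : 0 < e / 2 by rewrite divr_gt0.
apply: (@sub_finite_set _ _
  ([set i | e / 2 / (`|a| + 1) <= `|x i|] `|` [set i | e / 2 <= `|y i|])); last first.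
  by rewrite finite_setU; split; [apply: x0; rewrite divr_gt0|exact: y0].
move=> i /= ei; have [yi|yi] := leP (e / 2) `|y i|; [by right|left].
rewrite ler_pdivrMr// leNgt; apply/negP => xi.
suff : `|a * x i + y i| < e by rewrite ltNge ei.
apply: le_lt_trans (ler_normD _ _) _.
move/ltW: xi => xi; rewrite [ltRHS](splitr e) ler_ltD// normrM (le_trans _ xi)//.
by rewrite mulrC ler_wpM2l// lerDl.
Qed.

HB.instance Definition _ := GRing.isSubmodClosed.Build _ _ c0_pred
  c0_submod_closed.
HB.instance Definition _ := [isSub for c0_val].
HB.instance Definition _ := [Choice of c0 by <:].
HB.instance Definition _ := [SubChoice_isSubLmodule of c0 by <:].

Lemma c0_finite (x : c0) (e : R) : 0 < e -> finite_set [set i | e <= `|x i|].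
Proof. by have := c0_in x; rewrite inE; exact. Qed.

Lemma c0_bounded (x : c0) : bounded_on [set: I] x.
Proof.
have [s sE] : exists s : seq R, (fun i => `|x i|) @` [set i | 1 <= `|x i|] = [set` s].
  by apply/finite_seqP/finite_image/c0_finite.
exists (1 + \sum_(r <- s) `|r|) => i _.
have s0 (t : seq R) : 0 <= \sum_(r <- t) `|r| by apply: sumr_ge0.
have [x1|/ltW x1] := leP 1 `|x i|; last by rewrite (le_trans x1)// lerDl.
have : [set` s] `|x i| by rewrite -sE; exists i.
move=> /= /(big_rem _) ->; rewrite /= normr_id addrCA lerDl addr_ge0//; exact: s0.
Qed.

Let norm (x : c0) : R := supnorm [set: I] x.

Let normD x y : norm (x + y) <= norm x + norm y.
Proof. by apply: supnormD; exact: c0_bounded. Qed.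

Let normZ (l : R) x : norm (l *: x) = `|l| * norm x.
Proof. by apply: supnormZ; exact: c0_bounded. Qed.

Let norm_eq0 x : norm x = 0 -> x = 0.
Proof.
move=> x0; apply/val_inj/funext => i.
exact: (supnorm0_eq0 (c0_bounded x) x0).
Qed.

HB.instance Definition _ := Lmodule_isNormed.Build R c0 normD normZ norm_eq0.

Lemma c0_normE (x : c0) : `|x| = supnorm [set: I] x.
Proof. by []. Qed.

End C0.

Section BoundedOperators.
Context (R : realType) (V W : normedModType R).

Definition clin_pred : {pred V -> W} :=
  mem [set f : V -> W | linear f /\ continuous f].

(* Continuous linear maps with the operator norm. *)
Record clin := MkClin { clin_val :> V -> W ; clin_in : clin_val \in clin_pred }.

Lemma clin_submod_closed : submod_closed clin_pred.
Proof.
split.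
  rewrite inE; split; last by move=> x; exact: cvg_cst.
  by move=> a u v; rewrite scaler0 addr0.
move=> a f g; rewrite !inE => -[lf cf] [lg cg]; split.
  move=> b u v; rewrite [LHS]/(a *: f _ + g _) [X in _ = _ + X]/(a *: f _ + g _).
  rewrite [X in _ = _ *: X + _]/(a *: f _ + g _) lf lg !scalerDr !scalerA.
  by rewrite [a * b]mulrC addrACA.
move=> x.
by apply: cvgD; [apply: cvgZ; [exact: cvg_cst|exact: cf]|exact: cg].
Qed.

HB.instance Definition _ := GRing.isSubmodClosed.Build _ _ clin_pred
  clin_submod_closed.
HB.instance Definition _ := [isSub for clin_val].
HB.instance Definition _ := [Choice of clin by <:].
HB.instance Definition _ := [SubChoice_isSubLmodule of clin by <:].

Lemma clin_linear (f : clin) : linear f.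
Proof. by have := clin_in f; rewrite inE => -[]. Qed.

HB.instance Definition _ (f : clin) :=
  GRing.isLinear.Build R V W *:%R (clin_val f) (clin_linear f).

Lemma clin_continuous (f : clin) : continuous f.
Proof. by have := clin_in f; rewrite inE => -[]. Qed.

Let unit_ball : set V := [set v | `|v| <= 1].

Lemma clin_bounded (f : clin) : bounded_on unit_ball f.
Proof.
have /linear_boundedP[M [_ fM]] : bounded_near (clin_val f) (nbhs (0 : V)).
  exact/linear_bounded_continuous/clin_continuous.
exists (`|M| + 1) => v /= v1.
have Mlt : M < `|M| + 1 by rewrite (le_lt_trans (ler_norm M))// ltrDl.
apply: le_trans (fM _ Mlt v) _.
by rewrite ler_piMr// addr_ge0.
Qed.

Let norm (f : clin) : R := supnorm unit_ball f.

Let normD f g : norm (f + g) <= norm f + norm g.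
Proof. by apply: supnormD; exact: clin_bounded. Qed.

Let normZ (l : R) f : norm (l *: f) = `|l| * norm f.
Proof. by apply: supnormZ; exact: clin_bounded. Qed.

Let norm_eq0 f : norm f = 0 -> f = 0.
Proof.
move=> f0; apply/val_inj/funext => v.
have [->|v0] := eqVneq v 0; first exact: linear0.
have : f (`|v|^-1 *: v) = 0.
  apply: (supnorm0_eq0 (clin_bounded f) f0).
  by rewrite /unit_ball/= normrZ normfV normr_id mulVf// normr_eq0.
by rewrite linearZ => /eqP; rewrite scaler_eq0 invr_eq0 normr_eq0 (negPf v0) => /eqP.
Qed.

HB.instance Definition _ := Lmodule_isNormed.Build R clin normD normZ norm_eq0.

Lemma clin_normE (f : clin) : `|f| = supnorm [set v : V | `|v| <= 1] f.
Proof. by []. Qed.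

End BoundedOperators.

(* Class C^n on [U] in the Frechet sense: the successive derivatives are maps
   into the spaces of continuous linear maps with the operator norm.
   Differentiability and continuity at the points of [U] refer to the whole
   space; this is the usual notion when [U] is open. *)
Fixpoint smooth_nat (R : realType) (V : normedModType R) (n : nat)
    (W : normedModType R) (U : set V) (f : V -> W) : Prop :=
  if n is n'.+1 then
    exists Df : V -> clin V W,
      (forall x, U x -> differentiable f x /\ 'd f x = Df x :> (V -> W)) /\
      smooth_nat n' U Df
  else forall x, U x -> {for x, continuous f}.

(* [None] stands for the order infinity. *)
Definition smooth_on (R : realType) (V W : normedModType R) (m : option nat)
    (U : set V) (f : V -> W) : Prop :=
  if m is Some n then smooth_nat n U f else forall n, smooth_nat n U f.

Section SmoothNotions.
Context (R : realType) (m : option nat).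

Definition bump_function (X : normedModType R) (b : X -> R) : Prop :=
  (exists x, b x <> 0) /\
  exists B : set X, bounded_set B /\ forall x, ~ B x -> b x = 0.

Definition has_smooth_bump (X : normedModType R) : Prop :=
  exists b : X -> R, bump_function b /\ smooth_on m [set: X] b.

Definition open_cover (X : topologicalType) (C : set (set X)) : Prop :=
  (forall U, C U -> open U) /\ \bigcup_(U in C) U = [set: X].

(* By local finiteness every sum below has finitely many nonzero terms, so
   that [\sum_(a \in setT)] is the actual sum. *)
Definition locally_finite_partition_of_unity (X : topologicalType)
    (A : choiceType) (phi : A -> X -> R) : Prop :=
  [/\ forall a x, 0 <= phi a x,
      forall x : X, exists2 N : set X, nbhs x N &
        finite_set [set a | exists2 y, N y & phi a y != 0] &
      forall x, \sum_(a \in [set: A]) phi a x = 1].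

Definition subordinate (X : topologicalType) (A : Type) (phi : A -> X -> R)
    (C : set (set X)) : Prop :=
  forall a, exists2 U, C U & closure [set x | phi a x != 0] `<=` U.

Definition has_smooth_partitions_of_unity (X : normedModType R) : Prop :=
  forall C : set (set X), open_cover C ->
    exists (A : choiceType) (phi : A -> X -> R),
      [/\ locally_finite_partition_of_unity phi,
          subordinate phi C &
          forall a, smooth_on m [set: X] (phi a)].

(* [T] is not assumed linear, but it is assumed continuous for the norms; in
   particular the set where a coordinate is nonzero is open, as the phrase
   "of class C^m on the set where it is not zero" presupposes. Without
   continuity a coordinate could jump at the boundary of that set, and such a
   [T] would exist on C(K) for every scattered compact K. *)
Definition talagrand_operator (K : topologicalType) (cptK : compact [set: K])
    (G : Type) (T : Cfun R cptK -> c0 R (K * G)) : Prop :=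
  [/\ continuous T,
      forall f : Cfun R cptK, f <> 0 -> exists (t : K) (u : G), `|f t| = `|f| /\ T f (t, u) <> 0 &
      forall (t : K) (u : G),
        smooth_on m [set f : Cfun R cptK | T f (t, u) <> 0]
          (fun f => T f (t, u) : R)].

Definition has_talagrand_operator (K : topologicalType)
    (cptK : compact [set: K]) : Prop :=
  exists (G : Type) (T : Cfun R cptK -> c0 R (K * G)), talagrand_operator T.

End SmoothNotions.

(* Main.v *)
From HB Require Import structures.
Require Import Defs.
From mathcomp Require Import all_boot all_order all_algebra finmap.
From mathcomp Require Import all_classical all_reals all_analysis.
From mathcomp Require Import ring lra.

(** Write X for the Banach space of continuous functions on K.  Two of the four
implications between bump, Talagrand operator and partitions of unity are
short.  A member of a partition of unity that does not vanish at 0 is a bump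
if the cover is made of the open ball of radius 2 and the complement of the
closed unit ball ([partition_bump]).  Given a Talagrand operator T, suitably
scaled, put
  b(f) = e(1 - S(f)),    S(f) = sum over (t,u) of s_(t,u)(f),
on the open unit ball and b = 0 outside, where e(x) = exp(-1/x) for x > 0 and
e = 0 elsewhere, and s_(t,u) is a smooth function of (1 - f(t)^2) / T(f)(t,u)^2
that vanishes where this ratio is at least 1 and is at least 1 where the ratio
is at most 1/2.  Inside the ball 1 - f(t)^2 stays away from 0, so the sum is
locally finite because T takes its values in c_0; near a point f outside the
open ball the term at a point where |f| attains its norm is at least 1, so that
b vanishes there ([talagrand_bump]).

The real content is that a bump of class C^m, m >= 1, gives the other two.

A C^1 bump forces K to be scattered ([bump_scattered]).  If P were closed and
without isolated points, the function p(f) = max of f on P would be rough: from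
any f it can be raised at unit speed along many disjointly supported
directions, and the derivative of the bump, a bounded functional, is small on
one of them.  Hence one can climb along p while the bump hardly changes; a
maximal climb ends inside the unit ball, where it could be continued.

A scattered compact space carries a well-order with open initial segments
([scattered_order]), and every point t then has a clopen neighbourhood V t of
which t is the largest point ([clopen_system]).  Call a finite set F an
antichain if no point of F lies in V t for another point t of F.  The key fact
is that a closed set G contains exactly one antichain F with G covered by the
V t, t in F.  It exists because one can take the largest point z of G, remove
V z and go on, and the order is well-founded ([canonical_cover]).  It is unique
because the largest point that belongs to only one of two such antichains would
have to lie in some V t with t larger ([canonical_unique]).

Apply this to G = {x in W : g(x) >= q} where W is clopen, g = (f - c)^2, and
q < q' are rationals such that g takes no value between q and q'; there are
plenty of them because a scattered space has no image with interior
([value_gap]).  The statement that F is the antichain of G is then stable under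
small perturbations of f, and it is tested by the function [cover_weight]: a
product of factors e(g(t) - p2), t in F, and of a bump evaluated at e(g - q)
restricted to W minus the V t.  Only the second factor needs the bump of X: it
checks smoothly that g stays small on a clopen set.  For fixed W, c, q, q' and
variable F, at most one of these functions is nonzero near a given f
([cover_weight_uniq]).  Thus an uncountable family of C^m functions on X splits
into countably many discrete families.

Talagrand operator.  Take W = K, c = 0 and q just below the square of the norm
of f.  The largest point of F is then the largest point where |f| attains its
norm ([tal_coord_attains]), and coordinates indexed by the largest point of F
and by (q, q', F), weighted by powers of 1/2, form a Talagrand operator.

Partitions of unity.  Cutting K along the sets V t and repeating with other
values of c, one reaches after finitely many steps a partition of K into clopen
pieces on which f is almost constant ([approx_exists]).  The data of these steps
form a sigma-discrete family, each of whose members comes with a step function;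
multiplying by bumps around the step functions gives C^m functions of small
support whose sets of nonvanishing cover X.  The usual device makes the family
locally finite ([loc_weight_loc_finite]), and it remains to divide by the sum. *)

Set Implicit Arguments.
Unset Strict Implicit.
Unset Printing Implicit Defensive.
Import Order.TTheory GRing.Theory Num.Theory.
Import numFieldNormedType.Exports.
Local Open Scope classical_set_scope.
Local Open Scope ring_scope.

(** * Frechet derivatives and functions of class C^n *)

Lemma sum_remainder (W : zmodType) (a b c d e f : W) :
  a + b - (c + d) - (e + f) = (a - c - e) + (b - d - f).
Proof. by rewrite (opprD c) (addrACA a b) (opprD e) (addrACA (a - c)). Qed.

Lemma bilinear_remainder (W : zmodType) (p b c h k l : W) :
  p - b - (c + h) = k - b - c + (p - k - l) + (l - h).
Proof.
rewrite -[RHS]addrA (addrA (p - k - l)) subrK [RHS]addrC -sum_remainder.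
by rewrite (opprD k) addrA addrK (addrC h).
Qed.

Section Frechet.
Context {R : realType}.
Implicit Types V W Z : normedModType R.

Definition fderiv V W (f : V -> W) (x : V) (A : clin V W) : Prop :=
  forall e : R, 0 < e ->
    \forall u \near (0 : V), `|f (x + u) - f x - A u| <= e * `|u|.

Lemma fderivP V W (f : V -> W) x (A : clin V W) :
  fderiv f x A <-> differentiable f x /\ 'd f x = A :> (V -> W).
Proof.
split=> [fA|[dfx dE] e e0].
  have H : f \o shift x = cst (f x) + clin_val A +o_ 0 id.
    apply/eqaddoP => e e0; near=> u.
    change (`|f (u + x) - (f x + A u)| <= e * `|u|).
    rewrite opprD addrA [u + x]addrC.
    by near: u; exact: fA.
  have D : 'd f x = clin_val A :> (V -> W).
    exact: (diff_unique (@clin_continuous _ _ _ A) H).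
  split=> //; apply/diff_locallyP; rewrite D; split=> //.
  exact: clin_continuous.
have /eqaddoP /(_ _ e0) H := diff_locally dfx.
near=> u; rewrite -dE -addrA -opprD [x + u]addrC.
by near: u; exact: H.
Unshelve. all: by end_near. Qed.

Lemma smooth_natS V W n (U : set V) (f : V -> W) :
  smooth_nat n.+1 U f <->
  exists Df : V -> clin V W, (forall x, U x -> fderiv f x (Df x)) /\
    smooth_nat n U Df.
Proof.
by split=> -[Df [H1 H2]]; exists Df; split=> // x Ux; apply/fderivP; exact: H1.
Qed.

Lemma fderiv_continuous V W (f : V -> W) x A :
  fderiv f x A -> {for x, continuous f}.
Proof. by move=> /fderivP[df _]; exact: differentiable_continuous. Qed.

Lemma clin_opnorm V W (A : clin V W) v : `|A v| <= `|A| * `|v|.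
Proof.
have [->|v0] := eqVneq v 0; first by rewrite linear0 !normr0 mulr0.
have v0' : 0 < `|v| by rewrite normr_gt0.
rewrite -ler_pdivrMr// clin_normE.
have -> : `|A v| / `|v| = `|A (`|v|^-1 *: v)|.
  by rewrite linearZ normrZ normfV normr_id mulrC.
apply: (supnorm_ub (clin_bounded A)) => /=.
by rewrite normrZ normfV normr_id mulVf// normr_eq0.
Qed.

Lemma clin_normle V W (A : clin V W) M :
  0 <= M -> (forall v, `|A v| <= M * `|v|) -> `|A| <= M.
Proof.
move=> M0 AM; rewrite clin_normE; apply: supnorm_le => // v /= v1.
by apply: le_trans (AM v) _; rewrite ler_piMr.
Qed.

(** Continuous linear maps are built from plain functions by this total
operation, so that the proofs of linearity and boundedness stay out of the
terms; the value at a function that is not continuous linear is never used.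
[toclinE] is the only way in. *)
Definition toclin V W (f : V -> W) : clin V W :=
  if pselect (f \in @clin_pred R V W) is left p then MkClin p else 0.

Lemma toclinE V W (f : V -> W) : linear f ->
  (exists M, forall v, `|f v| <= M * `|v|) -> toclin f = f :> (V -> W).
Proof.
move=> lf [M fM]; rewrite /toclin; case: pselect => // -[].
rewrite inE; split => //.
pose g := GRing.isLinear.Build R V W *:%R f lf.
pose G : {linear V -> W} := HB.pack f g.
suff H : bounded_near G (nbhs (0 : V)).
  exact: (iffLR (@linear_bounded_continuous R V W G) H).
apply/linear_boundedP; exists `|M|; split; first exact: normr_real.
move=> r Mr v; apply: le_trans (fM v) _; apply: ler_wpM2r => //.
by apply: le_trans (ltW Mr); exact: ler_norm.
Qed.

Lemma clinP V W (A B : clin V W) : A = B :> (V -> W) -> A = B.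
Proof. by move=> AB; apply: val_inj. Qed.

Lemma clinDE V W (A B : clin V W) u : (A + B) u = A u + B u.
Proof. by []. Qed.
Lemma clinZE V W (A : clin V W) a u : (a *: A) u = a *: A u.
Proof. by []. Qed.

Lemma smooth_nat_sub V W n (U U' : set V) (f : V -> W) :
  U `<=` U' -> smooth_nat n U' f -> smooth_nat n U f.
Proof.
elim: n W f => [|n IH] W f UU'; first by move=> H x /UU'; exact: H.
move=> [Df [H1 H2]]; exists Df; split; first by move=> x /UU'; exact: H1.
exact: IH.
Qed.

Lemma near_addr V (x : V) (P : set V) :
  (\forall y \near x, P y) -> \forall u \near (0 : V), P (x + u).
Proof.
rewrite (near_shift 0 x) subr0 => H.
by apply: filterS H => u /=; rewrite [u + x]addrC.
Qed.

Lemma fderiv_near V W (f g : V -> W) x A :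
  (\forall y \near x, f y = g y) -> fderiv f x A -> fderiv g x A.
Proof.
move=> fg fA e e0.
have fgx : f x = g x by exact: nbhs_singleton fg.
have fg' : \forall u \near (0 : V), f (x + u) = g (x + u).
  exact: near_addr fg.
by near=> u; rewrite -fgx -(near fg' u)//; near: u; exact: fA.
Unshelve. all: by end_near. Qed.

Lemma smooth_nat_near V W n (U : set V) (f g : V -> W) :
  (forall x, U x -> \forall y \near x, f y = g y) ->
  smooth_nat n U f -> smooth_nat n U g.
Proof.
move=> fg; case: n => [|n].
  move=> cf x Ux; have fgx := fg _ Ux.
  have E : f x = g x by exact: nbhs_singleton fgx.
  have := cf _ Ux; rewrite /prop_for /continuous_at E; apply: cvg_trans.
  by apply: near_eq_cvg; apply: filterS fgx.
move=> /smooth_natS[Df [H1 H2]]; apply/smooth_natS; exists Df; split=> // x Ux.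
by apply: fderiv_near (H1 _ Ux); exact: fg.
Qed.

Lemma smooth_nat_eq V W n (U : set V) (f g : V -> W) :
  smooth_nat n U f -> f =1 g -> smooth_nat n U g.
Proof. by move=> sf /funext <-. Qed.

(** The witnesses for the derivative given on the various open sets agree,
because the derivative at a point is unique; the global witness is therefore
the derivative computed pointwise. *)
Lemma smooth_nat_local V W n (U : set V) (f : V -> W) :
  (forall x, U x -> exists O, [/\ open O, O x & smooth_nat n O f]) ->
  smooth_nat n U f.
Proof.
elim: n W f => [|n IH] W f H.
  by move=> x Ux; have [ O [_ Ox cf]] := H _ Ux; exact: cf.
pose D x := toclin ('d f x).
have DE O Df : (forall x, O x -> fderiv f x (Df x)) -> forall x, O x -> Df x = D x.
  move=> Hd x /Hd /fderivP[_ dE]; apply: clinP.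
  rewrite /D dE toclinE//; first exact: clin_linear.
  by exists `|Df x| => v; exact: clin_opnorm.
apply/smooth_natS; exists D; split.
  move=> x /H[ O [_ Ox /smooth_natS[Df [Hd _]]]].
  by rewrite -(DE _ _ Hd)//; exact: Hd.
apply: IH => x /H[ O [oO Ox /smooth_natS[Df [Hd sD]]]]; exists O; split=> //.
apply: smooth_nat_near sD => y Oy.
have := open_nbhs_nbhs (conj oO Oy); apply: filterS => z Oz.
exact: DE Hd _ Oz.
Qed.

Lemma smooth_nat_le1 V W n (U : set V) (f : V -> W) :
  smooth_nat n.+1 U f -> smooth_nat n U f.
Proof.
elim: n W f => [|n IH] W f.
  by move=> /smooth_natS[Df [H _]] x /H; exact: fderiv_continuous.
by move=> /smooth_natS[Df [H sD]]; apply/smooth_natS; exists Df; split=> //; exact: IH.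
Qed.

Lemma smooth_nat_le V W n p (U : set V) (f : V -> W) :
  (n <= p)%N -> smooth_nat p U f -> smooth_nat n U f.
Proof.
elim: p => [|p IH]; first by rewrite leqn0 => /eqP ->.
rewrite leq_eqVlt => /orP[/eqP -> //|]; rewrite ltnS => np H.
by apply: IH np _; exact: smooth_nat_le1.
Qed.

Lemma smooth_cst V W n (U : set V) (c : W) : smooth_nat n U (fun=> c).
Proof.
elim: n W c => [|n IH] W c; first by move=> x _; exact: cvg_cst.
apply/smooth_natS; exists (fun=> 0); split => // x _ e e0.
apply: nearW => u; rewrite subrr sub0r -[X in - X]/(0 : W) oppr0 normr0.
by rewrite mulr_ge0// ltW.
Qed.

Lemma smooth_clin V W n (U : set V) (A : clin V W) : smooth_nat n U A.
Proof.
case: n => [|n]; first by move=> x _; exact: clin_continuous.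
apply/smooth_natS; exists (fun=> A); split; last exact: smooth_cst.
move=> x _ e e0; apply: nearW => u.
by rewrite linearD addrAC addrK subrr normr0 mulr_ge0// ltW.
Qed.

Lemma smooth_linear V W n (U : set V) (f : V -> W) : linear f ->
  (exists M, forall v, `|f v| <= M * `|v|) -> smooth_nat n U f.
Proof.
by move=> lf bf; rewrite -(toclinE lf bf); exact: smooth_clin.
Qed.

Lemma smoothD V W n (U : set V) (f g : V -> W) :
  smooth_nat n U f -> smooth_nat n U g -> smooth_nat n U (fun x => f x + g x).
Proof.
elim: n W f g => [|n IH] W f g.
  by move=> cf cg x Ux; apply: cvgD; [exact: cf|exact: cg].
move=> /smooth_natS[Df [Hf sDf]] /smooth_natS[Dg [Hg sDg]]; apply/smooth_natS.
exists (fun x => Df x + Dg x); split; last exact: IH.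
move=> x Ux e e0; have e2 : 0 < e / 2 by rewrite divr_gt0.
near=> u; rewrite clinDE.
have -> : f (x + u) + g (x + u) - (f x + g x) - (Df x u + Dg x u) =
  (f (x + u) - f x - Df x u) + (g (x + u) - g x - Dg x u).
  exact: sum_remainder.
apply: le_trans (ler_normD _ _) _; rewrite [X in X * _]splitr mulrDl lerD//.
  by near: u; exact: Hf.
by near: u; exact: Hg.
Unshelve. all: by end_near. Qed.

(** Bounded bilinear maps carry the whole calculus: products, compositions of
operators and multiplication in C(K) are all of this kind. *)
Definition bounded_bilinear W1 W2 W3 (B : W1 -> W2 -> W3) := [/\ forall y, linear (B^~ y),
  forall x, linear (B x) & exists C, forall x y, `|B x y| <= C * (`|x| * `|y|)].

Lemma bounded_bilinear_bound W1 W2 W3 (B : W1 -> W2 -> W3) : bounded_bilinear B ->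
  exists2 C, 0 < C & forall x y, `|B x y| <= C * (`|x| * `|y|).
Proof.
case=> _ _ [C HC]; exists (`|C| + 1); first by rewrite ltr_wpDl.
move=> x y; apply: le_trans (HC x y) _; apply: ler_wpM2r.
  by rewrite mulr_ge0.
by apply: le_trans (ler_norm C) _; rewrite lerDl.
Qed.

Section Bil.
Variables (W1 W2 W3 : normedModType R) (B : W1 -> W2 -> W3) (hB : bounded_bilinear B).

Let BDl x x' y : B (x + x') y = B x y + B x' y.
Proof. by have [H _ _] := hB; have := H y 1 x x'; rewrite !scale1r. Qed.
Let BDr x y y' : B x (y + y') = B x y + B x y'.
Proof. by have [_ H _] := hB; have := H x 1 y y'; rewrite !scale1r. Qed.
Let B0r x : B x 0 = 0.
Proof. by apply: (addrI (B x 0)); rewrite -BDr !addr0. Qed.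
Let B0l y : B 0 y = 0.
Proof. by apply: (addrI (B 0 y)); rewrite -BDl !addr0. Qed.
Let BZl a x y : B (a *: x) y = a *: B x y.
Proof. by have [H _ _] := hB; have := H y a x 0; rewrite !addr0 B0l addr0. Qed.
Let BZr a x y : B x (a *: y) = a *: B x y.
Proof. by have [_ H _] := hB; have := H x a y 0; rewrite !addr0 B0r addr0. Qed.
Let BNl x y : B (- x) y = - B x y.
Proof. by rewrite -scaleN1r BZl scaleN1r. Qed.
Let BNr x y : B x (- y) = - B x y.
Proof. by rewrite -scaleN1r BZr scaleN1r. Qed.

(** The derivative of x |-> B (f x) (g x) is made of B again, applied to one
function and to the derivative of the other.  [bilr] and [bill] are these two
bilinear maps. *)
Definition bilr V (w : W1) (T : clin V W2) : clin V W3 := toclin (fun u => B w (T u)).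
Definition bill V (T : clin V W1) (w : W2) : clin V W3 := toclin (fun u => B (T u) w).

Lemma bilrE V w (T : clin V W2) u : bilr w T u = B w (T u).
Proof.
have [C C0 HC] := bounded_bilinear_bound hB.
rewrite /bilr toclinE//; first by move=> a x y; rewrite linearP BDr BZr.
exists (C * (`|w| * `|T|)) => v; apply: le_trans (HC _ _) _.
by rewrite -!mulrA !ler_wpM2l//; [exact: ltW|exact: clin_opnorm].
Qed.

Lemma billE V (T : clin V W1) w u : bill T w u = B (T u) w.
Proof.
have [C C0 HC] := bounded_bilinear_bound hB.
rewrite /bill toclinE//; first by move=> a x y; rewrite linearP BDl BZl.
exists (C * (`|T| * `|w|)) => v; apply: le_trans (HC _ _) _.
rewrite -!mulrA ler_wpM2l//; first exact: ltW.
by rewrite (mulrC `|w|) mulrA ler_wpM2r//; exact: clin_opnorm.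
Qed.

Lemma bounded_bilinear_bilr V : bounded_bilinear (@bilr V).
Proof.
have [C C0 HC] := bounded_bilinear_bound hB; split.
- move=> T a x y; apply/clinP/funext => u.
  by rewrite clinDE clinZE !bilrE BDl BZl.
- move=> w a S T; apply/clinP/funext => u.
  by rewrite clinDE clinZE !bilrE clinDE clinZE BDr BZr.
exists C => w T; apply: clin_normle => [|v].
  by rewrite !mulr_ge0// ltW.
rewrite bilrE; apply: le_trans (HC _ _) _.
by rewrite -!mulrA !ler_wpM2l//; [exact: ltW|exact: clin_opnorm].
Qed.

Lemma bounded_bilinear_bill V : bounded_bilinear (@bill V).
Proof.
have [C C0 HC] := bounded_bilinear_bound hB; split.
- move=> w a S T; apply/clinP/funext => u.
  by rewrite clinDE clinZE !billE clinDE clinZE BDl BZl.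
- move=> T a x y; apply/clinP/funext => u.
  by rewrite clinDE clinZE !billE BDr BZr.
exists C => T w; apply: clin_normle => [|v].
  by rewrite !mulr_ge0// ltW.
rewrite billE; apply: le_trans (HC _ _) _.
rewrite -!mulrA ler_wpM2l//; first exact: ltW.
by rewrite (mulrC `|w|) mulrA ler_wpM2r//; exact: clin_opnorm.
Qed.

Lemma bounded_bilinear_continuous V (f : V -> W1) (g : V -> W2) x :
  {for x, continuous f} -> {for x, continuous g} ->
  {for x, continuous (fun y => B (f y) (g y))}.
Proof.
move=> cf cg; have [C C0 HC] := bounded_bilinear_bound hB.
apply/cvgrPdist_le => /= e e0.
pose M := C * (`|f x| + `|g x| + 1).
have M0 : 0 < M by rewrite mulr_gt0// ltr_wpDl// addr_ge0.
pose d := Num.min (e / (2 * M)) 1.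
have d0 : 0 < d by rewrite lt_min ltr01 divr_gt0// mulr_gt0.
have dM : d * (2 * M) <= e by rewrite -ler_pdivlMr ?mulr_gt0// ge_min lexx.
have d1 : d <= 1 by rewrite ge_min lexx orbT.
move/cvgrPdist_le/(_ _ d0): cf => cf; move/cvgrPdist_le/(_ _ d0): cg => cg.
near=> y.
have fy : `|f x - f y| <= d by near: y.
have gy : `|g x - g y| <= d by near: y.
have -> : B (f x) (g x) - B (f y) (g y) =
   B (f x) (g x - g y) + B (f x - f y) (g y).
  by rewrite BDr BNr BDl BNl addrA subrK.
have gy' : `|g y| <= `|g x| + 1.
  by rewrite -lerBlDl; apply: (le_trans (lerB_dist _ _)); rewrite distrC; exact: le_trans gy d1.
apply: (le_trans (ler_normD _ _)); apply: (le_trans _ dM).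
apply: (@le_trans _ _ (d * M + d * M)); last by rewrite [leRHS]mulrCA mulr_natl mulr2n.
apply: lerD.
  apply: le_trans (HC _ _) _; rewrite /M [leRHS]mulrCA ler_pM2l// mulrC.
  by apply: ler_pM => //; rewrite -addrA lerDl addr_ge0.
apply: le_trans (HC _ _) _; rewrite /M [leRHS]mulrCA ler_pM2l//.
by apply: ler_pM => //; apply: le_trans gy' _; rewrite -addrA lerDr.
Unshelve. all: by end_near. Qed.

Lemma bounded_bilinear_fderiv V (f : V -> W1) (g : V -> W2) x F G :
  fderiv f x F -> fderiv g x G ->
  fderiv (fun y => B (f y) (g y)) x (bilr (f x) G + bill F (g x)).
Proof.
move=> fF gG e e0; have [C C0 HC] := bounded_bilinear_bound hB.
have cg := fderiv_continuous gG.
pose M := C * (`|f x| + `|g x| + 1 + `|F|).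
have M0 : 0 < M by rewrite mulr_gt0// ltr_wpDr// ltr_wpDl// addr_ge0.
pose d := Num.min (e / (3 * M)) 1.
have d0 : 0 < d by rewrite lt_min ltr01 divr_gt0// mulr_gt0.
have dM : d * (3 * M) <= e by rewrite -ler_pdivlMr ?mulr_gt0// ge_min lexx.
have d1 : d <= 1 by rewrite ge_min lexx orbT.
have cg' : \forall u \near (0 : V), `|g x - g (x + u)| <= d.
  by move/cvgrPdist_le/(_ _ d0): cg => cg; exact: near_addr cg.
near=> u; rewrite clinDE bilrE billE.
have gu : `|g x - g (x + u)| <= d by near: u.
have fu : `|f (x + u) - f x - F u| <= d * `|u| by near: u; exact: fF.
have gu' : `|g (x + u) - g x - G u| <= d * `|u| by near: u; exact: gG.
have gy' : `|g (x + u)| <= `|g x| + 1.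
  by rewrite -lerBlDl; apply: (le_trans (lerB_dist _ _)); rewrite distrC; exact: le_trans gu d1.
have -> : B (f (x + u)) (g (x + u)) - B (f x) (g x) - (B (f x) (G u) + B (F u) (g x)) =
  B (f x) (g (x + u) - g x - G u) + B (f (x + u) - f x - F u) (g (x + u))
  + B (F u) (g (x + u) - g x).
  by rewrite !BDr !BDl !BNr !BNl; exact: bilinear_remainder.
apply: le_trans (ler_normD _ _) _; apply: (@le_trans _ _ (d * (3 * M) * `|u|)); last first.
  by rewrite ler_wpM2r.
have -> : d * (3 * M) * `|u| = M * (d * `|u|) + M * (d * `|u|) + M * (`|u| * d).
  by ring.
apply: lerD.
  apply: le_trans (ler_normD _ _) _; apply: lerD; apply: le_trans (HC _ _) _;
    rewrite /M -mulrA ler_pM2l//.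
    by apply: ler_pM => //; rewrite -!addrA lerDl !addr_ge0.
  rewrite mulrC; apply: ler_pM => //; apply: le_trans gy' _.
  by have := normr_ge0 (f x); have := normr_ge0 F; lra.
apply: le_trans (HC _ _) _; rewrite /M -mulrA ler_pM2l// mulrA.
apply: ler_pM => //; last by rewrite distrC.
apply: le_trans (clin_opnorm _ _) _; rewrite ler_wpM2r//.
by rewrite lerDr !addr_ge0.
Unshelve. all: by end_near. Qed.

End Bil.

(** Leibniz: the derivative is a sum of two bounded bilinear expressions in
functions of class C^n.  The induction therefore ranges over all bilinear maps
and all target spaces at once. *)
Lemma smooth_bil V W1 W2 W3 (B : W1 -> W2 -> W3) n (U : set V) f g :
  bounded_bilinear B -> smooth_nat n U f -> smooth_nat n U g ->
  smooth_nat n U (fun x => B (f x) (g x)).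
Proof.
elim: n W1 W2 W3 B f g => [|n IH] W1 W2 W3 B f g hB.
  by move=> cf cg x Ux; apply: bounded_bilinear_continuous => //; [exact: cf|exact: cg].
move=> sf sg; have := smooth_nat_le1 sf; have := smooth_nat_le1 sg.
move: sf sg => /smooth_natS[Df [Hf sDf]] /smooth_natS[Dg [Hg sDg]] sg sf.
apply/smooth_natS; exists (fun x => bilr B (f x) (Dg x) + bill B (Df x) (g x)); split.
  by move=> x Ux; apply: bounded_bilinear_fderiv => //; [exact: Hf|exact: Hg].
apply: smoothD; first by apply: IH => //; exact: bounded_bilinear_bilr.
by apply: IH => //; exact: bounded_bilinear_bill.
Qed.

Definition clin_comp V W Z (A : clin W Z) (B : clin V W) : clin V Z :=
  toclin (fun u => A (B u)).

Lemma clin_compE V W Z (A : clin W Z) (B : clin V W) u : clin_comp A B u = A (B u).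
Proof.
rewrite /clin_comp toclinE//; first by move=> a x y; rewrite !linearP.
exists (`|A| * `|B|) => v; apply: le_trans (clin_opnorm _ _) _.
by rewrite -mulrA ler_wpM2l//; exact: clin_opnorm.
Qed.

Lemma bounded_bilinear_clin_comp V W Z : bounded_bilinear (@clin_comp V W Z).
Proof.
split.
- by move=> T a x y; apply/clinP/funext => u; rewrite clinDE clinZE !clin_compE.
- move=> T a x y; apply/clinP/funext => u.
  by rewrite clinDE clinZE !clin_compE clinDE clinZE linearP.
exists 1 => A B; rewrite mul1r; apply: clin_normle; first by rewrite mulr_ge0.
move=> v; rewrite clin_compE; apply: le_trans (clin_opnorm _ _) _.
by rewrite -mulrA ler_wpM2l//; exact: clin_opnorm.
Qed.

(** Chain rule: the derivative of the composite is the product, for the bounded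
bilinear composition of operators, of the composite of the derivative of g with
f and of the derivative of f. *)
Lemma smooth_comp V W Z n (U : set V) (U' : set W) (f : V -> W) (g : W -> Z) :
  (forall x, U x -> U' (f x)) -> smooth_nat n U' g -> smooth_nat n U f ->
  smooth_nat n U (fun x => g (f x)).
Proof.
move=> UU'; elim: n Z g => [|n IH] Z g.
  by move=> cg cf x Ux; apply: continuous_comp; [exact: cf|exact/cg/UU'].
move=> sg sf; have := smooth_nat_le1 sf.
move: sf sg => /smooth_natS[Df [Hf sDf]] /smooth_natS[Dg [Hg sDg]] sf.
apply/smooth_natS; exists (fun x => clin_comp (Dg (f x)) (Df x)); split.
  move=> x Ux; apply/fderivP.
  have /fderivP[df dfE] := Hf _ Ux; have /fderivP[dg dgE] := Hg _ (UU' _ Ux).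
  split; first exact: differentiable_comp.
  by rewrite diff_comp//; apply/funext => u; rewrite clin_compE /= dfE dgE.
apply: (smooth_bil (@bounded_bilinear_clin_comp V W Z)) => //.
exact: IH.
Qed.

Lemma smoothM V n (U : set V) (f g : V -> R) :
  smooth_nat n U f -> smooth_nat n U g -> smooth_nat n U (fun x => f x * g x).
Proof.
apply: (@smooth_bil V R R R (fun x y => x * y)); split.
- by move=> y a u v /=; rewrite mulrDl scalerAl.
- by move=> x a u v; rewrite mulrDr scalerAr.
- by exists 1 => x y; rewrite normrM mul1r.
Qed.

Lemma smoothZ V W n (U : set V) (f : V -> R) (g : V -> W) :
  smooth_nat n U f -> smooth_nat n U g -> smooth_nat n U (fun x => f x *: g x).
Proof.
apply: (@smooth_bil V R W W (fun x y => x *: y)); split.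
- by move=> y a u v /=; rewrite scalerDl scalerA.
- by move=> x a u v; rewrite scalerDr !scalerA mulrC.
- by exists 1 => x y; rewrite normrZ mul1r.
Qed.

Lemma smoothN V W n (U : set V) (f : V -> W) :
  smooth_nat n U f -> smooth_nat n U (fun x => - f x).
Proof.
move=> sf; apply: (@smooth_nat_eq _ _ _ _ (fun x => (-1) *: f x)).
  by apply: smoothZ => //; exact: smooth_cst.
by move=> x; rewrite scaleN1r.
Qed.

Lemma smoothB V W n (U : set V) (f g : V -> W) :
  smooth_nat n U f -> smooth_nat n U g -> smooth_nat n U (fun x => f x - g x).
Proof. by move=> sf sg; apply: smoothD => //; exact: smoothN. Qed.

Lemma smooth_sum V W n (U : set V) (I : Type) (r : seq I) (f : I -> V -> W) :
  (forall i, smooth_nat n U (f i)) ->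
  smooth_nat n U (fun x => \sum_(i <- r) f i x).
Proof.
move=> sf; elim: r => [|i r IH].
  by apply: (smooth_nat_eq (smooth_cst n U 0)) => x; rewrite big_nil.
by apply: (smooth_nat_eq (smoothD (sf i) IH)) => x; rewrite big_cons.
Qed.

Lemma smooth_prod V n (U : set V) (I : Type) (r : seq I) (f : I -> V -> R) :
  (forall i, smooth_nat n U (f i)) ->
  smooth_nat n U (fun x => \prod_(i <- r) f i x).
Proof.
move=> sf; elim: r => [|i r IH].
  by apply: (smooth_nat_eq (smooth_cst n U (1 : R))) => x; rewrite big_nil.
by apply: (smooth_nat_eq (smoothM (sf i) IH)) => x; rewrite big_cons.
Qed.

Lemma smooth_id V n (U : set V) : smooth_nat n U (fun x : V => x).
Proof. by apply: smooth_linear => //; exists 1 => v; rewrite mul1r. Qed.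

Lemma smooth_real n (U : set R) (f f' : R -> R) :
  (forall x, U x -> is_derive x 1 f (f' x)) -> smooth_nat n U f' ->
  smooth_nat n.+1 U f.
Proof.
move=> Hf sf'.
pose I : clin R R := toclin id.
have IE u : I u = u by rewrite /I toclinE//; exists 1 => v; rewrite mul1r.
apply/smooth_natS; exists (fun x => f' x *: I); split; last first.
  by apply: smoothZ => //; exact: smooth_cst.
move=> x /Hf [df dE]; apply/fderivP.
have df' : differentiable f x by apply/derivable1_diffP.
split=> //; rewrite diff1E//; apply/funext => u.
rewrite clinZE IE derive1E dE; exact: mulrC.
Qed.

Lemma smooth_inv n : smooth_nat n [set x : R | x != 0] (fun x => x^-1).
Proof.
elim: n => [|n IH]; first by move=> x x0; exact: inv_continuous.
apply: (@smooth_real _ _ _ (fun x => - (x^-1 * x^-1))); last first.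
  by apply: smoothN; exact: smoothM.
move=> x /= x0; apply: DeriveDef.
  by apply: derivableV => //; exact: derivable_id.
by rewrite deriveV// derive_id -exprVn expr2; exact: mulr1.
Qed.

Lemma smoothV V n (U : set V) (f : V -> R) :
  (forall x, U x -> f x != 0) -> smooth_nat n U f ->
  smooth_nat n U (fun x => (f x)^-1).
Proof. by move=> f0; apply: smooth_comp f0 _; exact: smooth_inv. Qed.

End Frechet.

(** * The flat function exp(-1/x) *)

Section Flat.
Context {R : realType}.

(** For j = 0 this is the classical function exp(-1/x), extended by 0.  The
factors x^(-j) are included because the family of all [flat j] is closed under
differentiation. *)
Definition flat (j : nat) (x : R) : R :=
  if 0 < x then x^-1 ^+ j * expR (- x^-1) else 0.

Lemma flat_pos j x : 0 < x -> 0 < flat j x.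
Proof. by move=> x0; rewrite /flat x0 mulr_gt0// ?expR_gt0// exprn_gt0// invr_gt0. Qed.

Lemma flat_nonpos j x : x <= 0 -> flat j x = 0.
Proof. by move=> x0; rewrite /flat ltNge x0. Qed.

Lemma flat_ge0 j x : 0 <= flat j x.
Proof.
by have [x0|x0] := ltP 0 x; [exact/ltW/flat_pos|rewrite flat_nonpos].
Qed.

(** The exponential exceeds each term of its series. *)
Lemma expRN_bound n (y : R) : 0 < y -> y ^+ n * expR (- y) <= n`!%:R.
Proof.
move=> y0; rewrite expRN ler_pdivrMr ?expR_gt0//.
case: n => [|n].
  by rewrite expr0 fact0 mul1r -expR0 ler_expR ltW.
have := @expR_ge1Dxn _ y n (ltW y0); rewrite -[X in _ -> _ <= X]mulrC => H.
rewrite -ler_pdivrMr ?ltr0n ?fact_gt0//; apply: le_trans H.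
by rewrite lerDr.
Qed.

(** The quadratic bound near 0 gives the value 0 to the derivative there. *)
Lemma flat_quad j x : flat j x <= (j.+2)`!%:R * x ^+ 2.
Proof.
have [x0|x0] := ltP 0 x; last by rewrite flat_nonpos// mulr_ge0// sqr_ge0.
rewrite -ler_pdivrMr ?exprn_gt0// /flat x0.
have := @expRN_bound j.+2 x^-1; rewrite invr_gt0 => /(_ x0); apply: le_trans.
by rewrite -exprVn mulrAC -exprD addn2.
Qed.

Lemma flat_bounded j x : `|flat j x| <= j`!%:R.
Proof.
rewrite ger0_norm ?flat_ge0//.
have [x0|x0] := ltP 0 x; last by rewrite flat_nonpos.
by rewrite /flat x0; apply: expRN_bound; rewrite invr_gt0.
Qed.

Lemma flat0_le1 x : flat 0 x <= 1.
Proof. by have := flat_bounded 0 x; rewrite ger0_norm ?flat_ge0// fact0. Qed.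

Definition dflat j x : R := flat j.+2 x - j%:R * flat j.+1 x.

Lemma is_derive_flat j (x : R) : is_derive x 1 (flat j) (dflat j x).
Proof.
have [x0|x0|<-] := ltgtP 0 x.
- apply: (@near_eq_is_derive R R R (fun x => x^-1 ^+ j * expR (- x^-1))).
    near=> y; have y0 : 0 < y by near: y; exact: lt_nbhsr.
    by rewrite /flat y0.
  have xn0 : x != 0 by rewrite gt_eqF.
  have dI : is_derive x 1 (fun y : R => y^-1) (- (x^-1 * x^-1)).
    apply: DeriveDef; first by apply: derivableV.
    by rewrite deriveV// derive_id -exprVn expr2; exact: mulr1.
  have dN : is_derive x 1 (fun y : R => - y^-1) (x^-1 * x^-1).
    by have := is_deriveN dI; rewrite opprK.
  have dE : is_derive x 1 (fun y : R => expR (- y^-1)) ((x^-1 * x^-1) * expR (- x^-1)).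
    have dexp : is_derive (- x^-1) 1 expR (expR (- x^-1)).
      apply: DeriveDef; first exact: derivable_expR.
      by rewrite -[in RHS](@derive_expR R).
    by have := @is_derive1_comp _ expR (fun y : R => - y^-1) x _ _ dexp dN; rewrite mulrC.
  have dP := is_deriveX j dI.
  have H := is_deriveM dP dE.
  rewrite exprfctE mulrfctE in H.
  case: H => Hd HE; apply: DeriveDef; first exact: Hd.
  rewrite HE.
  rewrite /dflat /flat x0 /= !/GRing.scale /=.
  case: j {dP Hd HE} => [|j] /=.
    rewrite mulr0n !mul0r expr0 !mul1r mulr0 addr0 subr0 expr2; ring.
  by rewrite !exprS -mulr_natl; ring.
- apply: (@near_eq_is_derive R R R (cst 0)).
    near=> y; have y0 : y < 0 by near: y; exact: lt_nbhsl.
    by rewrite flat_nonpos// ltW.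
  by rewrite /dflat !flat_nonpos ?ltW// mulr0 subr0; exact: is_derive_cst.
have : fderiv (flat j) 0 (0 : clin R R).
  move=> e e0; near=> u.
  rewrite add0r (flat_nonpos j (lexx 0)) subr0 subr0 ger0_norm ?flat_ge0//.
  apply: le_trans (flat_quad j u) _.
  rewrite -[u ^+ 2]real_normK ?num_real// expr2 mulrA ler_wpM2r//.
  have H : `|0 - u| <= e / (j.+2)`!%:R.
    by near: u; apply: cvgr_dist_le (@cvg_id _ _) _ _; rewrite divr_gt0// ltr0n fact_gt0.
  by rewrite mulrC -ler_pdivlMr ?ltr0n ?fact_gt0//; move: H; rewrite sub0r normrN.
move=> /fderivP[df dE]; apply: DeriveDef; first exact/derivable1_diffP.
by rewrite deriveE// dE /dflat !flat_nonpos// mulr0 subr0.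
Unshelve. all: by end_near. Qed.

Lemma smooth_flat n U j : smooth_nat n U (flat j).
Proof.
elim: n j => [|n IH] j.
  by move=> x _; have [/derivable1_diffP df _] := is_derive_flat j x;
    exact: differentiable_continuous.
apply: (@smooth_real _ _ _ _ (dflat j)); first by move=> x _; exact: is_derive_flat.
by apply: smoothB => //; apply: smoothM => //; exact: smooth_cst.
Qed.

Lemma dflat_bounded j : exists C, forall x, `|dflat j x| <= C.
Proof.
exists ((j.+2)`!%:R + j%:R * (j.+1)`!%:R) => x; apply: le_trans (ler_normB _ _) _.
by rewrite lerD ?flat_bounded// normrM normr_nat ler_wpM2l// flat_bounded.
Qed.

Lemma mvt_bound (f df : R -> R) (C : R) (a b : R) :
  (forall x : R, is_derive x 1 f (df x)) -> (forall x, `|x - a| <= `|b - a| -> `|df x| <= C) ->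
  `|f b - f a| <= C * `|b - a|.
Proof.
move=> Hf HC.
have cf : continuous f.
  by move=> x; have [/derivable1_diffP d _] := Hf x; exact: differentiable_continuous.
have [ab|ba] := leP a b.
  have [|c] := @MVT_segment _ f df a b ab (fun x _ => Hf x).
    exact: continuous_subspaceT.
  rewrite in_itv /= => /andP[ac cb] ->; rewrite normrM ler_wpM2r// HC//.
  by rewrite !ger0_norm ?subr_ge0// lerD2r.
have [|c] := @MVT_segment _ f df b a (ltW ba) (fun x _ => Hf x).
  exact: continuous_subspaceT.
rewrite in_itv /= => /andP[ac cb] E; rewrite distrC E normrM (distrC a b) ler_wpM2r// HC//.
by rewrite distrC (distrC b) !ger0_norm ?subr_ge0 ?(ltW ba)// lerB.
Qed.

Lemma flat_lip j : exists2 C, 0 < C & forall x y, `|flat j x - flat j y| <= C * `|x - y|.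
Proof.
have [C HC] := dflat_bounded j; exists (`|C| + 1); first by rewrite ltr_wpDl.
move=> x y; apply: (@mvt_bound _ (dflat j)); first exact: is_derive_flat.
by move=> z _; apply: le_trans (HC z) _; apply: le_trans (ler_norm _) _; rewrite lerDl.
Qed.

Lemma dflat_lip j : exists2 C, 0 < C & forall x y, `|dflat j x - dflat j y| <= C * `|x - y|.
Proof.
have [C1 C10 H1] := flat_lip j.+2; have [C2 C20 H2] := flat_lip j.+1.
exists (C1 + j%:R * C2); first by rewrite ltr_wpDr// mulr_ge0// ltW.
move=> x y; rewrite /dflat.
have -> : flat j.+2 x - j%:R * flat j.+1 x - (flat j.+2 y - j%:R * flat j.+1 y) =
  (flat j.+2 x - flat j.+2 y) - j%:R * (flat j.+1 x - flat j.+1 y) by ring.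
apply: le_trans (ler_normB _ _) _; rewrite mulrDl lerD//.
by rewrite normrM normr_nat -mulrA ler_wpM2l.
Qed.

(** Since the second derivative is bounded, the Taylor remainder is quadratic
uniformly on the line.  This uniformity is what makes composition with [flat j]
differentiable for the supremum norm. *)
Lemma flat_taylor j : exists2 C, 0 < C & forall x h,
  `|flat j (x + h) - flat j x - dflat j x * h| <= C * (`|h| * `|h|).
Proof.
have [C C0 HC] := dflat_lip j; exists C => // x h.
pose g y := flat j y - dflat j x * y.
have Hg (y : R) : is_derive y 1 g (dflat j y - dflat j x).
  have H1 := is_derive_flat j y.
  have H2 : is_derive y 1 (fun y : R => dflat j x * y) (dflat j x).
    by have := @is_deriveZ _ _ _ id (dflat j x) y 1 1 (is_derive_id _ _); rewrite [_ *: 1]mulr1.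
  exact: is_deriveB.
have := @mvt_bound g _ (C * `|h|) x (x + h) Hg.
have -> : g (x + h) - g x = flat j (x + h) - flat j x - dflat j x * h.
  by rewrite /g mulrDr; ring.
rewrite mulrA (_ : x + h - x = h); last by ring.
apply=> y yx; apply: le_trans (HC _ _) _.
by rewrite ler_wpM2l// ltW.
Qed.

End Flat.

Lemma lip_continuous (R : realType) (V W : normedModType R) (f : V -> W) x C :
  0 < C -> (forall y, `|f x - f y| <= C * `|x - y|) -> {for x, continuous f}.
Proof.
move=> C0 HC; apply/cvgrPdist_le => /= e e0; near=> y.
apply: le_trans (HC y) _; rewrite mulrC -ler_pdivlMr//; near: y.
by apply: cvgr_dist_le (@cvg_id _ _) _ _; rewrite divr_gt0.
Unshelve. all: by end_near. Qed.

(** * Smooth maps of the space C(K) into itself *)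

Section CfunAlg.
Context {R : realType} {K : topologicalType} {cptK : compact [set: K]}.
Notation X := (Cfun R cptK).

Lemma cnorm_ub (f : X) x : `|f x| <= `|f|.
Proof. by rewrite cfun_normE; exact: (supnorm_ub (cfun_bounded f)). Qed.

Lemma cnorm_le (f : X) M : 0 <= M -> (forall x, `|f x| <= M) -> `|f| <= M.
Proof. by move=> M0 fM; rewrite cfun_normE; exact: supnorm_le. Qed.

Definition tocfun (g : K -> R) : X :=
  if pselect (g \in @cts_pred R K) is left p then MkCfun cptK p else 0.

Lemma tocfunE g : continuous g -> tocfun g = g :> (K -> R).
Proof. by move=> cg; rewrite /tocfun; case: pselect => // -[]; rewrite inE. Qed.

Lemma cfunDE (f g : X) x : (f + g) x = f x + g x. Proof. by []. Qed.
Lemma cfunZE (f : X) a x : (a *: f) x = a * f x. Proof. by []. Qed.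
Lemma cfunBE (f g : X) x : (f - g) x = f x - g x. Proof. by []. Qed.
Lemma cfun0E x : (0 : X) x = 0. Proof. by []. Qed.
Lemma cfunP (f g : X) : f =1 g -> f = g.
Proof. by move=> /funext fg; apply: val_inj. Qed.

Definition cmul (f g : X) : X := tocfun (fun x => f x * g x).
Lemma cmulE f g x : cmul f g x = f x * g x.
Proof.
by rewrite tocfunE// => y; apply: cvgM; exact: cfun_continuous.
Qed.

Lemma bounded_bilinear_cmul : bounded_bilinear cmul.
Proof.
split.
- by move=> g a u v; apply: cfunP => x; rewrite cfunDE cfunZE !cmulE cfunDE cfunZE mulrDl mulrA.
- by move=> g a u v; apply: cfunP => x; rewrite cfunDE cfunZE !cmulE cfunDE cfunZE mulrDr mulrCA.
exists 1 => f g; rewrite mul1r; apply: cnorm_le; first by rewrite mulr_ge0.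
by move=> x; rewrite cmulE normrM ler_pM// cnorm_ub.
Qed.

Lemma smooth_cmul (V : normedModType R) n (U : set V) (f g : V -> X) :
  smooth_nat n U f -> smooth_nat n U g -> smooth_nat n U (fun x => cmul (f x) (g x)).
Proof. exact: smooth_bil bounded_bilinear_cmul. Qed.

Definition superpose (j : nat) (f : X) : X := tocfun (fun x => flat j (f x)).
Lemma superposeE j f x : superpose j f x = flat j (f x).
Proof.
rewrite tocfunE// => y; apply: continuous_comp; first exact: cfun_continuous.
by apply: (@smooth_flat _ 0 setT).
Qed.

(** The derivative at f is multiplication by the derivative of [flat j]
composed with f, which is again a combination of superposition operators. *)
Lemma smooth_superpose n U j : smooth_nat n U (superpose j).
Proof.
elim: n j => [|n IH] j.
  move=> f _; have [C C0 HC] := flat_lip (R := R) j.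
  apply: (lip_continuous C0) => g.
  apply: cnorm_le; first by rewrite mulr_ge0// ltW.
  move=> x; rewrite cfunBE !superposeE; apply: le_trans (HC _ _) _.
  by rewrite ler_pM2l//; exact: (cnorm_ub (f - g)).
pose M (g : X) : clin X X := toclin (cmul g).
have ME g u : M g u = cmul g u.
  have [_ H [C HC]] := bounded_bilinear_cmul; rewrite /M toclinE//.
  by exists (C * `|g|) => v; rewrite -mulrA.
have sM : smooth_nat n U (fun f => M (superpose j.+2 f) - j%:R *: M (superpose j.+1 f)).
  have s1 k : smooth_nat n U (fun f => M (superpose k f)).
    apply: (@smooth_comp _ _ _ _ _ _ setT _ M) (IH k) => //.
    have [H _ [C HC]] := bounded_bilinear_cmul; apply: smooth_linear.
      by move=> a u v; apply/clinP/funext => w; rewrite clinDE clinZE !ME; exact: H.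
    exists `|C| => g; apply: clin_normle => [|v]; first by rewrite mulr_ge0.
    rewrite ME -mulrA; apply: le_trans (HC _ _) _; rewrite ler_wpM2r ?mulr_ge0//.
    exact: ler_norm.
  by apply: smoothB => //; apply: smoothZ => //; exact: smooth_cst.
apply/smooth_natS; eexists; split; last exact: sM.
move=> f _ e e0 /=; have [C C0 HC] := flat_taylor (R := R) j.
near=> u.
rewrite [X in _ - X](_ : _ = cmul (superpose j.+2 f) u - j%:R *: cmul (superpose j.+1 f) u);
  last by rewrite -!ME.
apply: (@le_trans _ _ (C * (`|u| * `|u|))).
  apply: cnorm_le; first by rewrite !mulr_ge0// ltW.
  move=> x; rewrite !cfunBE cfunZE !cmulE !superposeE cfunDE mulrA -mulrBl.
  apply: le_trans (HC _ _) _; rewrite ler_pM2l//.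
  by apply: ler_pM => //; exact: cnorm_ub.
rewrite mulrA ler_wpM2r// mulrC -ler_pdivlMr//.
have : `|0 - u| <= e / C by near: u; apply: cvgr_dist_le (@cvg_id _ _) _ _; rewrite divr_gt0.
by rewrite sub0r normrN.
Unshelve. all: by end_near. Qed.

Lemma smooth_eval n U (t : K) : smooth_nat n U (fun f : X => f t).
Proof. by apply: smooth_linear => //; exists 1 => f; rewrite mul1r cnorm_ub. Qed.

End CfunAlg.

(** * A space C(K) with a C^1 bump has K scattered *)

Section Topo.
Context {K : topologicalType}.

Definition scattered := forall P : set K, closed P -> P !=set0 ->
  exists t, P t /\ exists O : set K, [/\ open O, O t & P `&` O `<=` [set t]].

(** The finite lists of indices, ordered by inclusion, form a filter, to which
the formulation of compactness by near coverings applies. *)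
Lemma compact_fincover (A : set K) (I : choiceType) (f : I -> set K) :
  compact A -> (forall i, open (f i)) -> (forall x, A x -> exists i, f i x) ->
  exists s : seq I, forall x, A x -> exists2 i, i \in s & f i x.
Proof.
move=> /compact_near_coveringP cA of_ cov.
pose F := filter_from [set: seq I] (fun s0 => [set s : seq I | {subset s0 <= s}]).
have FF : Filter F.
  apply: filter_from_filter; first by exists [::].
  move=> s1 s2 _ _; exists (s1 ++ s2) => // s /= H; split=> x xs; apply: H;
    by rewrite mem_cat xs ?orbT.
have [x Ax|s0 _ H] := cA _ F (fun s x => exists2 i, i \in s & f i x) FF.
  have [i fix_] := cov _ Ax.
  exists (f i, [set s : seq I | {subset [:: i] <= s}]) => /=.
    by split; [exact: open_nbhs_nbhs|exists [:: i]].
  by move=> [y s] /= [fy si]; exists i => //; apply: si; rewrite inE.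
by exists s0 => x Ax; exact: (H s0).
Qed.

End Topo.

Section Scattered.
Context {R : realType} {K : topologicalType} {cptK : compact [set: K]}.
Hypothesis hausK : hausdorff_space K.
Notation X := (Cfun R cptK).

Lemma urysohn_cfun (O : set K) t : open O -> O t ->
  exists w : X, [/\ w t = 1, forall x, 0 <= w x <= 1 & forall x, ~ O x -> w x = 0].
Proof.
move=> oO Ot.
have nK : normal_space K by exact: compact_normal.
have ct : closed [set t].
  by apply: accessible_closed_set1; exact: hausdorff_accessible.
have dis : ~` O `&` [set t] = set0.
  by rewrite -subset0 => x [nO xt]; apply: nO; rewrite xt.
have /(@uniform_separatorP _ R)[f [cf f01 f0 f1]] :=
  (@normal_separatorP R K).1 nK (~` O) [set t] (open_closedC oO) ct dis.
have fE : @tocfun R K cptK f = f :> (K -> R) by exact: tocfunE.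
exists (@tocfun R K cptK f); rewrite fE; split.
- by apply: f1; exists t.
- by move=> x; have /= := f01 (f x) (ex_intro2 _ _ x I erefl); rewrite in_itv.
- by move=> x nOx; apply: f0; exists x.
Qed.

(** Completeness of C(K), with a prescribed rate: the limit is the pointwise
supremum of the lower bounds u n - r n. *)
Lemma cfun_limit (u : nat -> X) (r : nat -> R) :
  (forall n m, `|u m - u n| <= r n + r m) -> (forall e, 0 < e -> exists n, r n < e) ->
  exists g : X, forall n, `|g - u n| <= r n.
Proof.
move=> ur r0.
have r_ge0 n : 0 <= r n.
  by have := ur n n; rewrite subrr normr0; lra.
have urx x n m : u m x - r m <= u n x + r n.
  have := le_trans (cnorm_ub (u m - u n) x) (ur n m); rewrite cfunBE.
  by move=> /(le_trans (ler_norm _)); lra.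
pose S x := [set u n x - r n | n in [set: nat]].
pose g x := sup (S x).
have gub x n : u n x - r n <= g x.
  apply: ub_le_sup; last by exists n.
  by exists (u n x + r n) => _ [m _ <-].
have glb x n : g x <= u n x + r n.
  apply: ge_sup; first by exists (u n x - r n); exists n.
  by move=> _ [m _ <-].
have gu x n : `|g x - u n x| <= r n.
  by rewrite ler_norml; apply/andP; split; have := gub x n; have := glb x n; lra.
have cg : continuous g.
  move=> x; apply/cvgrPdist_le => /= e e0.
  have [|n rn] := r0 (e / 3); first by rewrite divr_gt0.
  have /cvgrPdist_le/(_ (e / 3)) := @cfun_continuous _ _ _ (u n) x.
  rewrite divr_gt0// => /(_ isT) H; near=> y.
  have H1 : `|u n x - u n y| <= e / 3 by near: y.
  have := gu x n; have := gu y n; move: H1.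
  by rewrite !ler_norml => /andP[? ?] /andP[? ?] /andP[? ?]; apply/andP; split; lra.
exists (@tocfun R K cptK g) => n; apply: cnorm_le => // x.
by rewrite cfunBE tocfunE.
Unshelve. all: by end_near. Qed.

Variable b : X -> R.
Hypothesis b0 : b 0 = 1.
Hypothesis bout : forall x, 1 <= `|x| -> b x = 0.
Hypothesis bC1 : smooth_nat 1 setT b.

(** Otherwise one could pick, one after the other in pairwise disjoint open
subsets of O, arbitrarily many functions with values in [0, 1] on which |L|
exceeds e; with suitable signs their sum has norm at most 1, and L is large on
it. *)
Lemma small_direction (L : clin X R) (P O : set K) t0 e : 0 < e ->
  (forall O, open O -> O t0 -> exists s, [/\ P s, O s & s <> t0]) ->
  open O -> O t0 ->
  exists w : X, [/\ forall x, 0 <= w x <= 1, `|L w| <= e &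
    exists t, [/\ P t, O t & w t = 1]].
Proof.
move=> e0 Pt0 oO Ot0; apply: contrapT => nex.
suff H : forall N O', open O' -> O' t0 -> O' `<=` O ->
    exists z : X, [/\ forall x, `|z x| <= 1, forall x, ~ O' x -> z x = 0 & N%:R * e <= L z].
  (* N e > |L|, whereas a function of norm at most 1 with N e <= L will be produced *)
  pose N := Num.bound (`|L| / e).
  have [z [z1 _ zL]] := H N O oO Ot0 (@subset_refl _ O).
  have : N%:R * e <= `|L|.
    apply: (le_trans zL); apply: (le_trans (ler_norm _)).
    apply: (le_trans (clin_opnorm L z)); rewrite ler_piMr//.
    by apply: cnorm_le.
  rewrite -ler_pdivlMr// leNgt => /negP; apply.
  by apply: le_lt_trans (archi_boundP _) => //; rewrite divr_ge0// ltW.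
elim=> [|N IH] O' oO' O't0 O'O.
  exists 0; split => [x|//|]; first by rewrite cfun0E normr0.
  by rewrite mul0r linear0.
have [t [Pt O't tt0]] := Pt0 _ oO' O't0.
have := hausK; rewrite open_hausdorff => /(_ t t0) [|[A B] /= [tA t0B] [oA oB /eqP AB]].
  exact/eqP.
rewrite !inE in tA t0B.
have [w [wt w01 wO]] := urysohn_cfun (openI oO' oA) (conj O't tA).
have Lw : e < `|L w|.
  rewrite ltNge; apply/negP => Lw; apply: nex; exists w; split => //.
  by exists t; split => //; exact: O'O.
have [z [z1 zO zL]] := IH (O' `&` B) (openI oO' oB) (conj O't0 t0B)
   (subset_trans (@subIsetl _ _ _) O'O).
pose s : R := Num.sg (L w).
have s1 : `|s| <= 1 by rewrite /s normr_sg lern1 leq_b1.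
exists (z + s *: w); split.
- move=> x; rewrite cfunDE cfunZE.
  have [Bx|nBx] := pselect ((O' `&` B) x).
    rewrite wO ?mulr0 ?addr0// => -[_ Ax]; move: Bx => [_ Bx].
    by have : (A `&` B) x by []; rewrite AB.
  rewrite zO// add0r normrM; have /andP[w0 w1] := w01 x.
  by rewrite (ger0_norm w0) -[leRHS]mul1r ler_pM.
- move=> x nO; rewrite cfunDE cfunZE zO ?wO ?mulr0 ?addr0// => -[]//.
rewrite linearD linearZ /= -natr1 mulrDl mul1r lerD//.
by rewrite [leRHS](_ : _ = `|L w|) ?ltW// /s [RHS]normrEsg.
Qed.

Section Perfect.
Variables (P : set K) (cP : closed P) (P0 : P !=set0).

Let p (f : X) : R := sup (f @` P).

Let cptP : compact P.
Proof. exact: subclosed_compact cP cptK (@subsetT _ _). Qed.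

Let p_ub (f : X) t : P t -> f t <= p f.
Proof.
move=> Pt; apply: ub_le_sup; last by exists t.
by exists `|f| => _ [s Ps <-]; exact: le_trans (ler_norm _) (cnorm_ub f s).
Qed.

Let p_lub (f : X) M : (forall t, P t -> f t <= M) -> p f <= M.
Proof.
move=> H; apply: ge_sup; first by have [t Pt] := P0; exists (f t); exists t.
by move=> _ [t Pt <-]; exact: H.
Qed.

Let p_att (f : X) : exists2 t, P t & f t = p f.
Proof.
have [|c] := @compact_EVT_max K R f P P0 cptP.
  by apply: continuous_subspaceT; exact: cfun_continuous.
rewrite inE => Pc H; exists c => //; apply/eqP; rewrite eq_le p_ub//=.
by apply: p_lub => t Pt; apply: H; rewrite inE.
Qed.

Let p_lip (f g : X) : p f <= p g + `|f - g|.
Proof.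
apply: p_lub => t Pt; have := p_ub g Pt.
have := le_trans (ler_norm _) (cnorm_ub (f - g) t); rewrite cfunBE; lra.
Qed.

Let p_norm (f : X) : p f <= `|f|.
Proof. by apply: p_lub => t _; exact: le_trans (ler_norm _) (cnorm_ub f t). Qed.

Let le (f g : X) := `|g - f| <= 2 * (p g - p f) /\ 2 * `|b g - b f| <= p g - p f.
Let S f := [set g : X | `|g| <= 1 /\ le f g].

Let le_refl f : le f f.
Proof. by rewrite /le !subrr !normr0 !mulr0. Qed.

Let le_tr f g h : le f g -> le g h -> le f h.
Proof.
move=> [fg1 fg2] [gh1 gh2]; split.
  have -> : h - f = (h - g) + (g - f) by rewrite addrA subrK.
  by apply: (le_trans (ler_normD _ _)); lra.
have -> : b h - b f = (b h - b g) + (b g - b f) by rewrite addrA subrK.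
by have := ler_normD (b h - b g) (b g - b f); lra.
Qed.

Let greedy f : exists g : X, `|f| <= 1 ->
  S f g /\ forall h, S f h -> p h - p f <= 2 * (p g - p f).
Proof.
have [f1|f1] := leP `|f| 1; last by exists f.
have Sf : S f f by split => //; exact: le_refl.
pose A := p @` S f; pose sg := sup A.
have hA : has_sup A.
  split; first by exists (p f); exists f.
  by exists 1 => _ [h [h1 _] <-]; exact: le_trans (p_norm h) h1.
have ub h : S f h -> p h <= sg by move=> Sh; apply: ub_le_sup; [case: hA|exists h].
have [sf|sf] := leP sg (p f).
  exists f => _; split => // h /ub ph; have := ph; lra.
have [|_ [g Sg <-] gs] := @sup_adherent _ A ((sg - p f) / 2) _ hA; first by lra.
by exists g => _; split=> // h /ub ph; move: gs; rewrite -/sg; lra.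
Qed.

(** If P had no isolated point, start at 0 and climb along the function
p(f) = max of f on P, with steps of length at most twice the gain in p and on
which b changes by at most half of that gain.  Steps that realise at least half
of the possible gain converge to a point x where no further gain is possible.
There b x >= 1/2, so x is interior to the unit ball, and adding a small multiple
of the function of [small_direction] does increase p. *)
Lemma perfect_isolated : exists t, P t /\
  exists O : set K, [/\ open O, O t & P `&` O `<=` [set t]].
Proof.
apply: contrapT => nis.
have perf t0 : P t0 -> forall O, open O -> O t0 -> exists s, [/\ P s, O s & s <> t0].
  move=> Pt0 O oO Ot0; apply: contrapT => nex; apply: nis; exists t0; split => //.
  exists O; split => // s [Ps Os]; apply: contrapT => st0; apply: nex.
  by exists s; split.
have [nx nxP] := choice greedy.
pose u n := iter n nx (0 : X).
have u1 n : `|u n| <= 1.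
  elim: n => [|n IH]; first by rewrite normr0.
  by have [[]] := nxP _ IH.
have uS n : le (u n) (u n.+1) by have [[]] := nxP _ (u1 n).
have ule n m : (n <= m)%N -> le (u n) (u m).
  elim: m => [|m IH]; first by rewrite leqn0 => /eqP ->.
  rewrite leq_eqVlt => /orP[/eqP -> //|]; rewrite ltnS => /IH H.
  exact: le_tr H (uS m).
pose A := [set p (u n) | n in [set: nat]]; pose l := sup A.
have hA : has_sup A.
  split; first by exists (p (u 0%N)); exists 0%N.
  by exists 1 => _ [n _ <-]; exact: le_trans (p_norm _) (u1 n).
have pl n : p (u n) <= l by apply: ub_le_sup; [case: hA|exists n].
pose r n := 2 * (l - p (u n)).
have r0 e : 0 < e -> exists n, r n < e.
  move=> e0; have [|_ [n _ <-] H] := @sup_adherent _ A (e / 2) _ hA; first by lra.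
  by exists n; rewrite /r; move: H; rewrite -/l; lra.
have r_ge0 n : 0 <= r n by rewrite /r; have := pl n; lra.
have ur1 n m : (n <= m)%N -> `|u m - u n| <= r n.
  by move=> /ule[H _]; apply: le_trans H _; rewrite /r; have := pl m; lra.
have ur n m : `|u m - u n| <= r n + r m.
  have [nm|mn] := leqP n m; first by have := ur1 _ _ nm; have := r_ge0 m; lra.
  by rewrite distrC; have := ur1 _ _ (ltnW mn); have := r_ge0 n; lra.
have [x xu] := cfun_limit ur r0.
have px : p x = l.
  apply/eqP; rewrite eq_le; apply/andP; split; apply/ler_addgt0Pr => e e0;
    have [|n rn] := r0 (e / 2); do ?lra; have := xu n; have := pl n; move: rn.
    by have := p_lip x (u n); rewrite /r; lra.
  by have := p_lip (u n) x; rewrite distrC /r; lra.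
have x1 : `|x| <= 1.
  apply/ler_addgt0Pr => e e0; have [n rn] := r0 e e0.
  have := ler_normD (x - u n) (u n); rewrite subrK.
  by have := xu n; have := u1 n; lra.
have rle n m : (n <= m)%N -> r m <= r n.
  by move=> /ule[H _]; rewrite /r; have := le_trans (normr_ge0 _) H; lra.
have /smooth_natS[Db [bD _]] := bC1.
have lex n : le (u n) x.
  split; first by rewrite px; exact: xu.
  apply/ler_addgt0Pr => e e0.
  have := fderiv_continuous (bD x I) => /cvgrPdist_le /(_ (e / 2)).
  rewrite divr_gt0// => /(_ isT) /nbhs_ballP[d /= d0 Hd].
  have [m rm] := r0 d d0.
  have : ball x d (u (maxn n m)).
    rewrite -ball_normE /=; apply: le_lt_trans (xu _) _.
    by apply: le_lt_trans rm; apply: rle; exact: leq_maxr.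
  move=> /Hd /= H1; have [_ H2] := ule _ _ (leq_maxl n m).
  have := ler_normD (b x - b (u (maxn n m))) (b (u (maxn n m)) - b (u n)).
  rewrite addrA subrK px; have := pl (maxn n m); lra.
have xmax h : S x h -> p h <= p x.
  move=> [h1 xh]; apply/ler_addgt0Pr => e e0; have [n rn] := r0 e e0.
  have [_ /(_ h)] := nxP _ (u1 n).
  have Sh : S (u n) h by split => //; exact: le_tr (lex n) xh.
  by move=> /(_ Sh); have := pl n.+1; rewrite /= -/(u n) px; move: rn; rewrite /r; lra.
have bx : 1 / 2 <= b x.
  have [_ H] := lex 0%N; rewrite /= b0 in H.
  have p0 : p 0 = 0.
    by apply/eqP; rewrite eq_le; have [t Pt] := P0; rewrite (@p_ub 0 _ Pt) andbT; apply: p_lub.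
  have := p_norm x; rewrite p0 in H.
  have := ler_norm (- (b x - 1)); rewrite normrN; lra.
have x1' : `|x| < 1.
  by rewrite ltNge; apply/negP => /bout bx0; move: bx; rewrite bx0; lra.
have [t0 Pt0 xt0] := p_att x.
have e8 : 0 < 8^-1 :> R by rewrite invr_gt0.
have /(_ _ e8) /nbhs_ballP[d /= d0 Hd] := bD x I.
(* a step short enough for the derivative estimate and for staying in the ball *)
pose s := Num.min (d / 2) (1 - `|x|).
have s0 : 0 < s by rewrite lt_min subr_gt0 x1' divr_gt0.
have sd : s < d by rewrite gt_min; apply/orP; left; lra.
have sx : s <= 1 - `|x| by rewrite ge_min lexx orbT.
pose O := [set t | p x - s / 2 < x t].
have oO : open O.
  apply: (@open_comp _ _ x [set y : R | p x - s / 2 < y]); last exact: open_gt.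
  by move=> t _; exact: cfun_continuous.
have Ot0 : O t0 by rewrite /O /= xt0; lra.
have [w [w01 Lw [t [Pt Ot wt]]]] := small_direction (Db x) e8 (perf _ Pt0) oO Ot0.
have w1 : `|w| <= 1.
  by apply: cnorm_le => // y; have /andP[? ?] := w01 y; rewrite ger0_norm.
have sw : `|s *: w| <= s by rewrite normrZ gtr0_norm// ler_piMr// ltW.
have pg : p x + s / 2 <= p (x + s *: w).
  have := @p_ub (x + s *: w) _ Pt; rewrite cfunDE cfunZE wt mulr1.
  by move: Ot; rewrite /O /=; lra.
have := xmax (x + s *: w); have : S x (x + s *: w); last by move=> /[swap] /[apply]; lra.
split; first by apply: le_trans (ler_normD _ _) _; lra.
split; first by rewrite addrC addKr; lra.
have /Hd /= : ball 0 d (s *: w).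
  by rewrite -ball_normE /= sub0r normrN; apply: le_lt_trans sd.
have LE : `|Db x (s *: w)| <= 8^-1 * s.
  by rewrite linearZ normrM gtr0_norm// mulrC ler_wpM2r// ltW.
have := ler_normD (b (x + s *: w) - b x - Db x (s *: w)) (Db x (s *: w)).
by rewrite subrK; lra.
Qed.
End Perfect.

Theorem bump_scattered : @scattered K.
Proof. by move=> P cP P0; exact: perfect_isolated. Qed.

End Scattered.

(** * Well-orders with open initial segments on scattered spaces *)

Section Tower.
Context {T : Type} (nx : set T -> set T).
Hypothesis nxS : forall U, U `<=` nx U.

(** Zermelo's construction of a well-order: the sets obtained from nothing by
unions and by the operation [nx], which later adds one isolated point of the
complement.  They are linearly ordered by inclusion. *)
Inductive tower : set T -> Prop :=
| tower_nx U : tower U -> tower (nx U)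
| tower_cup (C : set (set T)) : (forall U, C U -> tower U) ->
    tower (\bigcup_(U in C) U).

Let good B := forall A, tower A -> A `<=` B -> A = B \/ nx A `<=` B.

Let good_total B : good B -> forall A, tower A -> A `<=` B \/ nx B `<=` A.
Proof.
move=> gB A; elim=> [U tU [UB|BU]|C tC IH].
- by have [->|] := gB _ tU UB; [right|left].
- by right; apply: subset_trans BU _; exact: nxS.
- have [[U CU BU]|H] := pselect (exists2 U, C U & nx B `<=` U).
    by right=> x /BU Ux; exists U.
  left=> x [U CU Ux]; have [/(_ _ Ux)//|BU] := IH _ CU.
  by exfalso; apply: H; exists U.
Qed.

Let tower_good B : tower B -> good B.
Proof.
elim=> [U tU gU A tA AU|C tC gC A tA AC].
  have [AU'|UA] := good_total gU tA; last by left; apply/seteqP.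
  right; have [->//|nAU] := gU _ tA AU'.
  by apply: subset_trans nAU _; exact: nxS.
have [|nCA] := pselect (\bigcup_(U in C) U `<=` A); first by left; apply/seteqP.
right.
have [U CU nUA] : exists2 U, C U & ~ (U `<=` A).
  by apply: contrapT => H; apply: nCA => x [U CU Ux]; apply: contrapT => nAx;
    apply: H; exists U => // /(_ _ Ux).
have [AU|UA] := good_total (gC _ CU) tA; last first.
  by exfalso; apply: nUA => x Ux; apply: UA; exact: nxS.
have [AE|nAU] := gC _ CU _ tA AU; first by exfalso; apply: nUA; rewrite AE.
by move=> x /nAU Ux; exists U.
Qed.

Lemma tower_total A B : tower A -> tower B -> A `<=` B \/ nx B `<=` A.
Proof. by move=> tA tB; exact: good_total (tower_good tB) _ tA. Qed.

Hypothesis nx1 : forall U, tower U -> U = setT \/ exists t, ~ U t /\ nx U = U `|` [set t].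

Let I t := \bigcup_(U in [set U | tower U /\ ~ U t]) U.
Let tI t : tower (I t). Proof. by apply: tower_cup => U []. Qed.
Let nIt t : ~ I t t. Proof. by move=> [U [_ nUt] Ut]. Qed.
Let nxI t : nx (I t) = I t `|` [set t].
Proof.
have [IT|[s [ns E]]] := nx1 (tI t); first by exfalso; apply: (@nIt t); rewrite IT.
rewrite E; have [<-//|st] := pselect (s = t).
exfalso; apply: ns; exists (nx (I t)); last by rewrite E; right.
split; first exact: tower_nx.
by rewrite E => -[/nIt//|ts]; apply: st; rewrite ts.
Qed.

(** The points that precede t form the largest member of the tower without
t. *)
Lemma tower_order : exists lt : T -> T -> Prop, [/\ well_founded lt,
  forall s t, [\/ lt s t, s = t | lt t s],
  forall s t r, lt s t -> lt t r -> lt s r &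
  forall t, tower [set s | lt s t \/ s = t]].
Proof.
exists (fun s t => I t s); split.
- have tT : tower setT.
    pose W := \bigcup_(U in [set U | tower U]) U.
    have tW : tower W by apply: tower_cup.
    have [<-//|[t [nWt E]]] := nx1 tW.
    by exfalso; apply: nWt; exists (nx W); [exact: tower_nx|rewrite E; right].
  suff H : forall U, tower U -> forall s, U s -> Acc (fun s t => I t s) s.
    by move=> s; exact: H tT _ _.
  move=> U; elim=> [U' tU' IH s|C tC IH s [V CV Vs]]; last exact: IH CV _ Vs.
  have [UT|[t [nUt E]]] := nx1 tU'; first by move=> _; apply: IH; rewrite UT.
  rewrite [X in X s]E => -[/IH//|->]; constructor => r [A [tA nAt] Ar].
  have [AU|] := tower_total tA tU'; first by apply: IH; exact: AU.
  by move=> H; exfalso; apply: nAt; apply: H; rewrite E; right.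
- move=> s t.
  have [st|ts] := tower_total (tI s) (tI t); last first.
    by constructor 3; apply: ts; rewrite nxI; right.
  have [ts|st'] := tower_total (tI t) (tI s); last first.
    by constructor 1; apply: st'; rewrite nxI; right.
  have E : I s = I t by apply/seteqP.
  have : (I s `|` [set s]) s by right.
  rewrite -nxI E nxI => -[|->]; last by constructor 2.
  by rewrite -E => /nIt.
- move=> s t r st tr; have [tr'|rt] := tower_total (tI t) (tI r); first exact: tr'.
  by exfalso; apply: (@nIt t); apply: rt; apply: nxS.
- by move=> t; have := tower_nx (tI t); rewrite nxI.
Qed.

End Tower.

Section ScatteredOrder.
Context {K : topologicalType}.
Hypothesis sK : @scattered K.

(** Each member of the tower is open: the complement of an open set is closed,
so it has an isolated point, and adding that point keeps the set open. *)
Lemma scattered_order : exists lt : K -> K -> Prop, [/\ well_founded lt,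
  forall s t, [\/ lt s t, s = t | lt t s],
  forall s t r, lt s t -> lt t r -> lt s r &
  forall t, open [set s | lt s t \/ s = t]].
Proof.
have /choice[nx nxP] : forall U : set K, exists V : set K, U `<=` V /\
    (open U -> open V /\ (U = setT \/ exists t, ~ U t /\ V = U `|` [set t])).
  move=> U; have [oU|noU] := pselect (open U); last by exists U; split.
  have [UT|UT] := pselect (U = setT); first by exists U; split => // _; split => //; left.
  have [t [nUt [ O [oO Ot UO]]]] : exists t, (~` U) t /\
      exists O : set K, [/\ open O, O t & ~` U `&` O `<=` [set t]].
    apply: sK; first exact: open_closedC.
    apply/set0P/eqP => U0; apply: UT; by rewrite -[U]setCK U0 setC0.
  exists (U `|` [set t]); split; first by move=> x; left.
  move=> _; split; last by right; exists t.
  rewrite (_ : _ `|` _ = U `|` O); first exact: openU.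
  apply/seteqP; split => x [Ux|]; try by left.
    by move=> ->; right.
  have [Ux|nUx] := pselect (U x); first by left.
  by move=> Ox; right; apply: UO.
have tO U : tower nx U -> open U.
  elim=> [V _ oV|C _ IH]; first by have [_ /(_ oV)[]] := nxP V.
  by apply: bigcup_open => V CV; exact: IH.
have nxS U : U `<=` nx U by have [] := nxP U.
have nx1 U : tower nx U -> U = setT \/ exists t, ~ U t /\ nx U = U `|` [set t].
  by move=> /tO oU; have [_ /(_ oU)[]] := nxP U.
have [lt [wf tot tr op]] := tower_order nxS nx1.
by exists lt; split => // t; exact: tO.
Qed.

End ScatteredOrder.

Lemma clopen_setU (K : topologicalType) (A B : set K) : clopen A -> clopen B -> clopen (A `|` B).
Proof. by move=> [? ?] [? ?]; split; [exact: openU|exact: closedU]. Qed.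
Lemma clopen_setI (K : topologicalType) (A B : set K) : clopen A -> clopen B -> clopen (A `&` B).
Proof. by move=> [? ?] [? ?]; split; [exact: openI|exact: closedI]. Qed.
Lemma clopen_compl (K : topologicalType) (A : set K) : clopen A -> clopen (~` A).
Proof. by move=> [? ?]; split; [exact: closed_openC|exact: open_closedC]. Qed.
Lemma clopen_full (K : topologicalType) : clopen [set: K].
Proof. by split; [exact: openT|exact: closedT]. Qed.

Definition union_of (K : choiceType) (V : K -> set K) (F : seq K) : set K :=
  [set x | exists2 i, i \in F & V i x].

Lemma clopen_union_of (K : topologicalType) (V : K -> set K) F :
  (forall t, clopen (V t)) -> clopen (union_of V F).
Proof.
move=> cV; elim: F => [|t F IH].
  by rewrite (_ : union_of _ _ = set0); 
    [split; [exact: open0|exact: closed0]|rewrite -subset0 => x []].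
rewrite (_ : union_of _ _ = V t `|` union_of V F); first exact: clopen_setU.
apply/seteqP; split => x.
  by move=> [i]; rewrite inE => /orP[/eqP -> Vx|iF Vx]; [left|right; exists i].
move=> [Vx|[i iF Vx]]; first by exists t => //; rewrite inE eqxx.
by exists i => //; rewrite inE iF orbT.
Qed.

(** * Canonical finite covers in scattered compact spaces *)

Section Order.
Context {K : topologicalType} (lt : K -> K -> Prop).
Hypothesis wf : well_founded lt.
Hypothesis tot : forall s t, [\/ lt s t, s = t | lt t s].
Hypothesis ltr : forall s t r, lt s t -> lt t r -> lt s r.
Hypothesis op : forall t, open [set s | lt s t \/ s = t].
Hypothesis cptK : compact [set: K].
Hypothesis hausK : hausdorff_space K.

Lemma lt_irr t : ~ lt t t.
Proof. by elim/(well_founded_ind wf): t => t IH ltt; exact: (IH t ltt ltt). Qed.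

Lemma seq_max (G : set K) (s : seq K) : (exists2 t, t \in s & G t) ->
  exists z, [/\ z \in s, G z & forall t, t \in s -> G t -> lt t z \/ t = z].
Proof.
elim: s => [[]//|x s IH [t]].
have [[u us Gu] _ _|no] := pselect (exists2 t, t \in s & G t).
  have [z [zs Gz zmax]] := IH (ex_intro2 _ _ u us Gu).
  have [Gx|nGx] := pselect (G x); last first.
    exists z; split => //; first by rewrite inE zs orbT.
    by move=> y; rewrite inE => /orP[/eqP -> /nGx//|]; exact: zmax.
  have [xz|xz|zx] := tot x z.
  - exists z; split => //; first by rewrite inE zs orbT.
    by move=> y; rewrite inE => /orP[/eqP -> _|]; [left|exact: zmax].
  - exists z; split => //; first by rewrite inE zs orbT.
    by move=> y; rewrite inE => /orP[/eqP -> _|]; [right|exact: zmax].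
  - exists x; split => //; first by rewrite inE eqxx.
    move=> y; rewrite inE => /orP[/eqP -> _|ys Gy]; first by right.
    by left; have [yz|->//] := zmax _ ys Gy; exact: ltr yz zx.
rewrite inE => /orP[/eqP -> Gx|ts Gt]; last by exfalso; apply: no; exists t.
exists x; split => //; first by rewrite inE eqxx.
move=> y; rewrite inE => /orP[/eqP -> _|ys Gy]; first by right.
by exfalso; apply: no; exists y.
Qed.

(** Compactness, since the initial segments are open: finitely many of those
that end at a point of G cover G. *)
Lemma closed_max (G : set K) : closed G -> G !=set0 ->
  exists z, G z /\ forall t, G t -> lt t z \/ t = z.
Proof.
move=> cG [x0 Gx0].
have cptG : compact G by exact: subclosed_compact cG cptK (@subsetT _ _).
have [s Hs] : exists s : seq K, forall x, G x ->
    exists2 t, t \in s & G t /\ (lt x t \/ x = t).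
  apply: (@compact_fincover _ G K (fun t => [set x | G t /\ (lt x t \/ x = t)]) cptG).
    move=> t; have [Gt|nGt] := pselect (G t).
      rewrite (_ : [set x | _] = [set x | lt x t \/ x = t]); first exact: op.
      by apply/seteqP; split => x //= [].
    by rewrite (_ : [set x | _] = set0); [exact: open0|rewrite -subset0 => x []].
  by move=> x Gx; exists x; split; [|right].
have [t0 t0s [Gt0 _]] := Hs _ Gx0.
have [z [zs Gz zmax]] := seq_max (ex_intro2 _ _ t0 t0s Gt0).
exists z; split => // x /Hs[t ts [Gt xt]].
have [tz|<-//] := zmax _ ts Gt.
by left; case: xt => [xt|->//]; exact: ltr xt tz.
Qed.

(** Induction on the largest point of a closed set. *)
Lemma closed_ind (Q : set K -> Prop) :
  (forall G, closed G -> (forall G', closed G' ->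
     (exists2 z, G z & forall s, G' s -> lt s z) -> Q G') -> Q G) ->
  forall G, closed G -> Q G.
Proof.
move=> H.
have Hz z : forall G, closed G -> (forall s, G s -> lt s z) -> Q G.
  elim/(well_founded_ind wf): z => z IH G cG Gz; apply: H => // G' cG' [z' Gz' G'z'].
  by apply: (IH z') => //; exact: Gz.
by move=> G cG; apply: H => // G' cG' [z Gz G'z]; exact: Hz G'z.
Qed.

(** By induction on t.  Let N be a neighbourhood of t whose closure lies in the
given open set and in the initial segment ending at t.  The boundary of N is
compact and consists of smaller points, so finitely many clopen sets that avoid
t cover it; removing them from the interior of N leaves a clopen set. *)
Lemma clopen_base t (O : set K) : open O -> O t ->
  exists V, [/\ clopen V, V t, V `<=` O & forall s, V s -> lt s t \/ s = t].
Proof.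
elim/(well_founded_ind wf): t O => t IH O oO Ot.
pose O' := O `&` [set s | lt s t \/ s = t].
have oO' : open O' by apply: openI.
have O't : O' t by split => //; right.
have := @compact_regular K t setT hausK cptK (filterT) O' (open_nbhs_nbhs (conj oO' O't)).
move=> [N Nt NO'].
pose B := closure N `\` N°.
have cB : closed B.
  apply: closedI; first exact: closed_closure.
  by apply: open_closedC; exact: open_interior.
have cptB : compact B by exact: subclosed_compact cB cptK (@subsetT _ _).
have /choice[V VP] : forall s, exists V : set K,
    clopen V /\ (B s -> V s) /\ V `<=` O' `&` ~` [set t].
  move=> s; have [Bs|nBs] := pselect (B s); last first.
    by exists set0; split; [split; [exact: open0|exact: closed0]|split].
  have [clNs nNs] := Bs.
  have O's := NO' _ clNs.
  have st : s <> t by move=> st; apply: nNs; rewrite st; exact: Nt.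
  have lst : lt s t by have [_ []] := O's.
  have oO'' : open (O' `&` ~` [set t]).
    apply: openI => //; apply: closed_openC.
    by apply: accessible_closed_set1; exact: hausdorff_accessible.
  have [V [cV Vs VO _]] := IH s lst _ oO'' (conj O's st).
  by exists V.
have [F HF] := @compact_fincover K B K V cptB (fun s => (VP s).1.1)
  (fun x Bx => ex_intro _ x ((VP x).2.1 Bx)).
have cU := @clopen_union_of K V F (fun s => (VP s).1).
pose W := N° `\` union_of V F.
have WE : W = closure N `\` union_of V F.
  apply/seteqP; split => x [Nx nU]; split => //.
    by apply: subset_closure; exact: interior_subset.
  apply: contrapT => nNx; apply: nU.
  by have [|i iF Vx] := HF x; [split|exists i].
have WO' : W `<=` O' by rewrite WE => x [Nx _]; exact: NO'.
exists W; split.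
- split; first by apply: openI; [exact: open_interior|exact: (clopen_compl cU).1].
  by rewrite WE; apply: closedI; [exact: closed_closure|exact: (clopen_compl cU).2].
- split; first exact: Nt.
  by move=> [i _ /((VP i).2.2)[_]]; exact.
- by move=> x /WO'[].
- by move=> x /WO'[].
Qed.

Lemma clopen_system : exists V : K -> set K, forall t, [/\ clopen (V t), V t t &
  forall s, V t s -> lt s t \/ s = t].
Proof.
have /choice[V VP] : forall t, exists V : set K, [/\ clopen V, V t &
    forall s, V s -> lt s t \/ s = t].
  by move=> t; have [V [? ? _ ?]] := @clopen_base t setT openT I; exists V.
by exists V.
Qed.

(** By induction on the largest point z of a closed set: a smaller interval
avoids h z, and the points of the set with value in that interval form a closed
set with a smaller largest point. *)
Lemma value_gap (R : realType) (h : K -> R) (a b : R) : continuous h -> a < b ->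
  exists q q' : rat, [/\ a < ratr q, ratr q < ratr q' :> R, ratr q' < b &
    forall x, ~ (ratr q <= h x <= ratr q')].
Proof.
move=> ch ab.
have H : forall G, closed G -> forall a b : R, a < b -> exists q q' : R,
    [/\ a < q, q < q', q' < b & forall x, G x -> ~ (q <= h x <= q')].
  apply: closed_ind => G cG IH a1 b1 ab1.
  have [G0|/set0P/(closed_max cG)[z [Gz zmax]]] := eqVneq G set0.
    exists (a1 + (b1 - a1) / 3), (a1 + 2 * (b1 - a1) / 3); split; try lra.
    by move=> x; rewrite G0.
  have [a2 [b2 [aa2 ab2 bb2 zab]]] : exists a2 b2, [/\ a1 <= a2, a2 < b2, b2 <= b1 &
      ~ (a2 <= h z <= b2)].
    have [hz|hz] := leP (h z) ((a1 + b1) / 2).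
      exists (a1 + 2 * (b1 - a1) / 3), b1; split; lra.
    exists a1, ((a1 + b1) / 2); split; lra.
  pose G' := G `&` h @^-1` `[a2, b2].
  have cG' : closed G'.
    apply: closedI => //; apply: closed_comp; first by move=> x _; exact: ch.
    exact: interval_closed.
  have [|q [q' [aq qq' qb Gq]]] := IH G' cG' _ a2 b2 ab2.
    exists z => // s [Gs]; rewrite /= in_itv /= => hs.
    by have [//|sz] := zmax _ Gs; exfalso; apply: zab; rewrite -sz.
  exists q, q'; split => //; first exact: le_lt_trans aq.
    exact: lt_le_trans bb2.
  move=> x Gx /andP[qx xq]; apply: (Gq x); last by rewrite qx.
  split => //; rewrite /= in_itv /=; apply/andP; split.
    by apply: le_trans qx; exact: ltW.
  by apply: (le_trans xq); exact: ltW.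
have [q [q' [aq qq' qb Gq]]] := H setT closedT a b ab.
have [r1] := rat_in_itvoo qq'; rewrite in_itv /= => /andP[qr1 r1q].
have [r2] := rat_in_itvoo r1q; rewrite in_itv /= => /andP[r12 r2q].
exists r1, r2; split => //; [exact: lt_trans qr1|exact: lt_trans qb|].
move=> x /andP[rx xr]; apply: (Gq x I); apply/andP; split.
  by apply: le_trans rx; exact: ltW.
by apply: (le_trans xr); exact: ltW.
Qed.

Variable V : K -> set K.
Hypothesis VP : forall t, [/\ clopen (V t), V t t & forall s, V t s -> lt s t \/ s = t].

Definition antichain (F : {fset K}) :=
  forall s t, s \in F -> t \in F -> V t s -> s = t.

(** Take the largest point z of G, then continue with G minus V z, all of whose
points are smaller than z.  No later point lies in V z, and z lies in no V t
with t smaller. *)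
Lemma canonical_cover (G : set K) z : closed G -> G z ->
  (forall t, G t -> lt t z \/ t = z) ->
  exists F : {fset K}, [/\ z \in F, forall s, s \in F -> G s, antichain F & G `<=` union_of V F].
Proof.
move=> cG; move: G cG z; apply: closed_ind => G cG IH z Gz zmax.
pose G' := G `\` V z.
have [cV Vz Vzl] := VP z.
have cG' : closed G' by apply: closedI => //; exact: (clopen_compl cV).2.
have G'z s : G' s -> lt s z.
  by move=> [Gs nVs]; have [//|sz] := zmax _ Gs; exfalso; apply: nVs; rewrite sz.
have [G'0|/set0P/(closed_max cG')[z' [Gz' zmax']]] := eqVneq G' set0.
  exists [fset z]%fset; split.
  - by rewrite inE.
  - by move=> s; rewrite inE => /eqP ->.
  - by move=> s t; rewrite !inE => /eqP -> /eqP ->.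
  - move=> x Gx; exists z; first by rewrite inE.
    by apply: contrapT => nVx; have : G' x by []; rewrite G'0.
have [F [z'F FG aF GF]] := IH G' cG' (ex_intro2 _ _ z Gz G'z) z' Gz' zmax'.
exists (z |` F)%fset; split.
- by rewrite !inE eqxx.
- by move=> s; rewrite !inE => /orP[/eqP ->//|/FG[]].
- move=> s t; rewrite !inE => /orP[/eqP ->|sF] /orP[/eqP ->|tF] //; last exact: aF.
    have tz := G'z _ (FG _ tF); have [_ _ H] := VP t.
    by move=> /H[zt|//]; exfalso; exact: lt_irr (ltr zt tz).
  by have [_] := FG _ sF.
- move=> x Gx; have [Vx|nVx] := pselect (V z x); first by exists z => //; rewrite !inE eqxx.
  by have [|i iF Vx] := GF x; [split|exists i => //; rewrite !inE iF orbT].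
Qed.

(** Let z be the largest point that belongs to exactly one of F and F', say to
F.  As a point of G it lies in V s for some s in F', and s is larger than z, so
s belongs to both; but then z and s contradict that F is an antichain. *)
Lemma canonical_unique (G : set K) (F F' : {fset K}) :
  (forall s, s \in F -> G s) -> antichain F -> G `<=` union_of V F ->
  (forall s, s \in F' -> G s) -> antichain F' -> G `<=` union_of V F' -> F = F'.
Proof.
move=> FG aF GF F'G aF' GF'.
pose D := [set s | (s \in F) != (s \in F')].
have [[t tF Dt]|no] := pselect (exists2 t, t \in (F `|` F')%fset & D t); last first.
  apply/fsetP => s; apply: contrapT => sF; apply: no; exists s; last exact/eqP.
  rewrite inE; apply: contrapT => /negP; rewrite negb_or => /andP[/negPf s1 /negPf s2].
  by apply: sF; rewrite s1 s2.
have [z [zF Dz zmax]] := seq_max (ex_intro2 _ _ t tF Dt).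
have key (A B : {fset K}) : (forall s, s \in A -> G s) -> G `<=` union_of V B -> antichain B ->
    antichain A -> (forall t, t \in A -> t \notin B -> lt t z \/ t = z) ->
    (forall t, t \in B -> t \notin A -> lt t z \/ t = z) -> z \in A -> z \notin B -> False.
  move=> AG GB aB aA mA mB zA znB; have [s sB Vzs] := GB _ (AG _ zA).
  have zs : z <> s by move=> zs; move: znB; rewrite zs sB.
  have ltzs : lt z s by have [_ _ /(_ _ Vzs)[]] := VP s.
  have [sA|snA] := boolP (s \in A); first by apply: zs; exact: aA Vzs.
  have [sz|sz] := mB _ sB snA; first exact: lt_irr (ltr ltzs sz).
  by apply: zs.
have mem1 s : s \in F -> s \notin F' -> lt s z \/ s = z.
  move=> sF snF; apply: zmax; first by rewrite inE sF.
  by rewrite /D /= sF (negPf snF).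
have mem2 s : s \in F' -> s \notin F -> lt s z \/ s = z.
  move=> sF snF; apply: zmax; first by rewrite inE sF orbT.
  by rewrite /D /= sF (negPf snF).
exfalso; move: Dz; rewrite /D /=.
have [zF1|zF1] := boolP (z \in F); have [zF2|zF2] := boolP (z \in F') => // _.
  exact: (key F F').
exact: (key F' F).
Qed.

End Order.

(** * Smooth functions that recognise a canonical cover *)

Lemma mid_ge (R : realType) (p1 p2 a b : R) :
  `|a - b| < (p2 - p1) / 2 -> p2 < b -> (p1 + p2) / 2 <= a.
Proof. by rewrite ltr_norml => /andP[? ?] ?; lra. Qed.

Lemma mid_lt (R : realType) (p1 p2 a b : R) :
  `|a - b| < (p2 - p1) / 2 -> b < p1 -> a < (p1 + p2) / 2.
Proof. by rewrite ltr_norml => /andP[? ?] ?; lra. Qed.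

Section CfunMore.
Context {R : realType} {K : topologicalType} {cptK : compact [set: K]}.
Notation X := (Cfun R cptK).

Definition ind_cfun (W : set K) : X := tocfun (fun x => (x \in W)%:R).

Lemma ind_cfunE W x : clopen W -> ind_cfun W x = (x \in W)%:R.
Proof.
move=> [oW cW]; rewrite tocfunE// => y.
have loc : \forall u \near y, (y \in W)%:R = (u \in W)%:R :> R.
  have [Wy|nWy] := pselect (W y).
    have := open_nbhs_nbhs (conj oW Wy); apply: filterS => u Wu.
    by rewrite !mem_set.
  have := open_nbhs_nbhs (conj (closed_openC cW) nWy); apply: filterS => u nWu.
  by rewrite !memNset.
apply: (@near_cst_continuous _ _ ((y \in W)%:R : R)).
by apply: filterS loc => u ->.
Qed.

Definition cst_cfun (c : R) : X := tocfun (fun=> c).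
Lemma cst_cfunE c x : cst_cfun c x = c.
Proof. by rewrite tocfunE// => y; exact: cvg_cst. Qed.

(** Deviation from c.  The square makes it a smooth function of f, and its
superlevel sets treat values above and below c at once. *)
Definition sq_dev (c : R) (f : X) : X := cmul (f - cst_cfun c) (f - cst_cfun c).
Lemma sq_devE c f x : sq_dev c f x = (f x - c) ^+ 2.
Proof. by rewrite cmulE cfunBE cst_cfunE expr2. Qed.

Lemma smooth_sq_dev n U c : smooth_nat n U (sq_dev c).
Proof.
have H : smooth_nat n U (fun f : X => f - cst_cfun c).
  by apply: smoothB; [exact: smooth_id|exact: smooth_cst].
exact: smooth_cmul.
Qed.

Lemma flat0_mono (x y : R) : x <= y -> flat 0 x <= flat 0 y.
Proof.
move=> xy; have [x0|x0] := leP x 0; first by rewrite flat_nonpos// flat_ge0.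
have y0 : 0 < y by exact: lt_le_trans xy.
rewrite /flat x0 y0 !expr0 !mul1r ler_expR lerN2.
by rewrite lef_pV2// posrE.
Qed.

Variable bt : X -> R.
Hypothesis bt0 : 0 < bt 0.
Hypothesis bt_ge0 : forall f, 0 <= bt f.
Hypothesis bt_le1 : forall f, bt f <= 1.
Hypothesis bt_out : forall f, 1 <= `|f| -> bt f = 0.

(** A smooth test that g stays small on W: if g <= q on W then bt is evaluated at
0, and if g reaches r somewhere on W then it is evaluated at a point of norm at
least 1.  This is where a bump on the whole space is needed: if W is infinite,
no finite product of functions of the values of g can do it. *)
Definition upper_cutoff (W : set K) (q r : R) (g : X) : R :=
  bt ((flat 0 (r - q))^-1 *: cmul (ind_cfun W) (superpose 0 (g - cst_cfun q))).

Lemma upper_cutoff_neq0 W q r g : clopen W -> q < r -> upper_cutoff W q r g != 0 ->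
  forall x, W x -> g x < r.
Proof.
move=> cW qr nz x Wx; rewrite ltNge; apply/negP => rg.
have p0 : 0 < flat 0 (r - q) by rewrite flat_pos// subr_gt0.
move/eqP: nz; apply; apply: bt_out.
apply: le_trans (cnorm_ub _ x).
rewrite cfunZE cmulE ind_cfunE// mem_set// mul1r superposeE cfunBE cst_cfunE.
rewrite ger0_norm; last by rewrite mulr_ge0 ?invr_ge0 ?flat_ge0.
rewrite ler_pdivlMl// mulr1; apply: flat0_mono.
by rewrite lerB.
Qed.

Lemma upper_cutoff_pos W q r (g : X) :
  clopen W -> (forall x, W x -> g x <= q) -> 0 < upper_cutoff W q r g.
Proof.
move=> cW gq; rewrite /upper_cutoff (_ : _ *: _ = 0)//.
apply: cfunP => x; rewrite cfunZE cmulE ind_cfunE// superposeE cfunBE cst_cfunE cfun0E.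
have [Wx|nWx] := pselect (W x); last by rewrite memNset// mul0r mulr0.
have -> : flat 0 (g x - q) = 0 by apply: flat_nonpos; rewrite subr_le0 gq.
by rewrite !mulr0.
Qed.

Lemma smooth_upper_cutoff n U W q r : smooth_nat n setT bt -> smooth_nat n U (upper_cutoff W q r).
Proof.
move=> sb; apply: (@smooth_comp _ _ _ _ n _ setT) sb _ => //.
apply: smoothZ; first exact: smooth_cst.
apply: smooth_cmul; first exact: smooth_cst.
apply: (@smooth_comp _ _ _ _ n _ setT (fun g : X => g - cst_cfun q) (superpose 0)) => //.
  exact: smooth_superpose.
by apply: smoothB; [exact: smooth_id|exact: smooth_cst].
Qed.

Variable V : K -> set K.
Hypothesis cV : forall t, clopen (V t).

Definition admissible (W : set K) (q q' : rat) (F : {fset K}) :=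
  [/\ q < q', antichain V F & forall s, s \in F -> W s].

(** With g = (f - c)^2 and q < p1 < p2 < q' dividing the interval into thirds, the
weight does not vanish only if g > p2 at each point of F and g < p1 on the part
of W outside the V t, t in F.  Thus F is the canonical antichain of the set of
points of W where g is at least (p1 + p2) / 2. *)
Definition cover_weight (W : set K) (c q q' : rat) (F : {fset K}) (f : X) : R :=
  if pselect (admissible W q q' F) then
    (\prod_(s <- F) flat 0 ((sq_dev (ratr c) f) s - ratr (q + 2 * (q' - q) / 3))) *
    upper_cutoff (W `\` union_of V F) (ratr q) (ratr (q + (q' - q) / 3)) (sq_dev (ratr c) f)
  else 0.

Lemma smooth_cover_weight n W c q q' F : smooth_nat n setT bt ->
  smooth_nat n setT (cover_weight W c q q' F).
Proof.
move=> sb; rewrite /cover_weight; case: pselect => [ad_|nad_] /=; last exact: smooth_cst.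
apply: smoothM.
  apply: smooth_prod => s.
  apply: (@smooth_comp _ _ _ _ n _ setT (fun f => sq_dev (ratr c) f s - _) (flat 0)) => //.
    exact: smooth_flat.
  apply: smoothB; last exact: smooth_cst.
  apply: (@smooth_comp _ _ _ _ n _ setT (sq_dev (ratr c)) (fun g : X => g s)) => //.
    exact: smooth_eval.
  exact: smooth_sq_dev.
apply: (@smooth_comp _ _ _ _ n _ setT (sq_dev (ratr c)) (upper_cutoff _ _ _)) => //.
  exact: smooth_upper_cutoff.
exact: smooth_sq_dev.
Qed.

Lemma prod01 (I : Type) (r : seq I) (a : I -> R) : (forall i, 0 <= a i <= 1) ->
  0 <= \prod_(i <- r) a i <= 1.
Proof.
move=> H; elim: r => [|i r IH]; first by rewrite big_nil ler01 lexx.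
rewrite big_cons; have /andP[a0 a1] := H i; have /andP[b0 b1] := IH.
by rewrite mulr_ge0//= mulr_ile1.
Qed.

Lemma cover_weight01 W c q q' F f : 0 <= cover_weight W c q q' F f <= 1.
Proof.
rewrite /cover_weight; case: pselect => [ad_|nad_] /=; last by rewrite lexx ler01.
have /andP[a0 a1] := @prod01 _ F
  (fun s => flat 0 (sq_dev (ratr c) f s - ratr (q + 2 * (q' - q) / 3)))
  (fun s => introT andP (conj (flat_ge0 _ _) (flat0_le1 _))).
by rewrite mulr_ge0//= ?mulr_ile1// ?bt_ge0 ?bt_le1.
Qed.

Lemma cover_weight_neq0 W c q q' F f : clopen W -> cover_weight W c q q' F f != 0 ->
  [/\ admissible W q q' F,
   forall s, s \in F -> ratr (q + 2 * (q' - q) / 3) < sq_dev (ratr c) f s &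
   forall x, W x -> ~ union_of V F x -> sq_dev (ratr c) f x < ratr (q + (q' - q) / 3)].
Proof.
move=> cW; rewrite /cover_weight; case: pselect => [ad|nad_] /=; last by rewrite eqxx.
rewrite mulf_eq0 negb_or => /andP[n1 n2]; split => //.
  move=> s sF; rewrite ltNge; apply/negP => H; move/eqP: n1; apply.
  by rewrite (big_rem _ sF) /= flat_nonpos ?mul0r// subr_le0.
have [qq' _ _] := ad.
move=> x Wx nUx; apply: (upper_cutoff_neq0 _ _ n2) => //.
  by apply: clopen_setI => //; apply: clopen_compl; exact: clopen_union_of.
by rewrite ltr_rat; lra.
Qed.

(** Where g has no value between q and q', the superlevel sets of g for all
levels in between coincide. *)
Lemma cover_weight_pos W c q q' F f : clopen W -> admissible W q q' F ->
  (forall x, ~ (ratr q <= sq_dev (ratr c) f x <= ratr q')) ->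
  (forall s, s \in F -> ratr q <= sq_dev (ratr c) f s) ->
  (forall x, W x -> ratr q <= sq_dev (ratr c) f x -> union_of V F x) ->
  0 < cover_weight W c q q' F f.
Proof.
move=> cW ad gap Fq Wq; rewrite /cover_weight; case: pselect => [ad_|//] /=; apply: mulr_gt0.
  rewrite big_seq; apply: prodr_gt0 => s sF; apply: flat_pos; rewrite subr_gt0.
  have := gap s; rewrite Fq//= => /negP; rewrite -ltNge; apply: le_lt_trans.
  by rewrite ler_rat; have [qq' _ _] := ad; lra.
apply: upper_cutoff_pos.
  by apply: clopen_setI => //; apply: clopen_compl; exact: clopen_union_of.
move=> x [Wx nUx]; rewrite leNgt; apply/negP => H; apply: nUx; apply: Wq => //.
exact: ltW.
Qed.

Section Uniq.
Variable lt : K -> K -> Prop.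
Hypothesis wf : well_founded lt.
Hypothesis tot : forall s t, [\/ lt s t, s = t | lt t s].
Hypothesis ltr : forall s t r, lt s t -> lt t r -> lt s r.
Hypothesis VP : forall t, [/\ clopen (V t), V t t & forall s, V t s -> lt s t \/ s = t].

(** If f' is close to f, the antichain recognised by f' is the canonical
antichain of the superlevel set of the middle value (p1 + p2) / 2 for f, whose
definition does not involve f'. *)
Lemma cover_weight_uniq W c q q' (f : X) : clopen W -> exists N : set X, nbhs f N /\
  forall f1 f2 F1 F2, N f1 -> N f2 -> cover_weight W c q q' F1 f1 != 0 ->
    cover_weight W c q q' F2 f2 != 0 -> F1 = F2.
Proof.
move=> cW.
pose p1 : R := ratr (q + (q' - q) / 3); pose p2 : R := ratr (q + 2 * (q' - q) / 3).
have [qq'|nqq'] := boolP (q < q'); last first.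
  exists setT; split; first exact: filterT.
  by move=> f1 f2 F1 F2 _ _ /(cover_weight_neq0 cW)[[]]; rewrite (negPf nqq').
have p12 : p1 < p2 by rewrite ltr_rat; lra.
have cs : {for f, continuous (sq_dev (ratr c) : X -> X)} by exact: (@smooth_sq_dev 0 setT).
move/cvgrPdist_lt/(_ ((p2 - p1) / 2)): cs; rewrite divr_gt0 ?subr_gt0// => /(_ isT) HN.
eexists; split; first exact: HN.
have key (f' : X) x : `|sq_dev (ratr c) f - sq_dev (ratr c) f'| < (p2 - p1) / 2 ->
    `|sq_dev (ratr c) f x - sq_dev (ratr c) f' x| < (p2 - p1) / 2.
  by apply: le_lt_trans; exact: (cnorm_ub (_ - _)).
move=> f1 f2 F1 F2 /= N1 N2 /(cover_weight_neq0 cW)[[_ aF1 WF1] H1 G1].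
move=> /(cover_weight_neq0 cW)[[_ aF2 WF2] H2 G2].
have gen f' F : (forall s, s \in F -> W s) ->
   (forall s : K, s \in F -> p2 < sq_dev (ratr c) f' s) ->
   (forall x : K, W x -> ~ union_of V F x -> sq_dev (ratr c) f' x < p1) ->
   `|sq_dev (ratr c) f - sq_dev (ratr c) f'| < (p2 - p1) / 2 ->
   (forall s, s \in F -> (W `&` [set x | (p1 + p2) / 2 <= sq_dev (ratr c) f x]) s) /\
   W `&` [set x | (p1 + p2) / 2 <= sq_dev (ratr c) f x] `<=` union_of V F.
  move=> WF H G N'; split.
    move=> s sF; split; first exact: WF.
    exact: mid_ge (key _ s N') (H _ sF).
  move=> x [Wx /= px]; apply: contrapT => /(G _ Wx) Gx.
  by have := mid_lt (key _ x N') Gx; rewrite ltNge px.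
have [A1 B1] := gen _ _ WF1 H1 G1 N1; have [A2 B2] := gen _ _ WF2 H2 G2 N2.
exact: (canonical_unique wf tot ltr VP A1 aF1 B1 A2 aF2 B2).
Qed.

End Uniq.
End CfunMore.

(** * Locally finite and sigma-discrete families of functions *)

Section LocallyFinite.
Context {R : realType} {V : normedModType R} {I : choiceType}.

Definition loc_finite (D : set I) (w : I -> V -> R) := forall x : V, exists N : set V, nbhs x N /\
  exists J : seq I, forall y i, N y -> D i -> w i y != 0 -> i \in J.

Lemma fsum_seq (D : set I) (a : I -> R) (J : seq I) :
  (forall i, D i -> a i != 0 -> i \in J) ->
  \sum_(i \in D) a i = \sum_(i <- [seq i <- undup J | i \in D]) a i.
Proof.
move=> HJ; rewrite (fsbigE [seq i <- undup J | i \in D]) /=.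
- by rewrite [LHS]big_filter_cond [RHS]big_filter; apply: eq_bigl => i; rewrite andbb.
- by rewrite filter_uniq// undup_uniq.
- by move=> i /=; rewrite mem_filter => /andP[/set_mem].
move=> i Di; rewrite mem_filter mem_set//= mem_undup => iJ.
by apply/eqP; apply: contraT => ai; rewrite (HJ _ Di ai) in iJ.
Qed.

Lemma fsum_ge_term (D : set I) (a : I -> R) (J : seq I) i :
  (forall i, D i -> a i != 0 -> i \in J) -> (forall i, 0 <= a i) -> D i ->
  a i <= \sum_(i \in D) a i.
Proof.
move=> HJ a0 Di; rewrite (fsum_seq HJ).
have [->|ai] := eqVneq (a i) 0; first exact: sumr_ge0.
rewrite (big_rem i) /=; first by rewrite lerDl sumr_ge0.
by rewrite mem_filter mem_set//= mem_undup HJ.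
Qed.

Lemma smooth_fsum n D w : loc_finite D w -> (forall i, smooth_nat n setT (w i)) ->
  smooth_nat n setT (fun x => \sum_(i \in D) w i x).
Proof.
move=> lf sw; apply: smooth_nat_local => x _.
have [N [Nx [J HJ]]] := lf x.
exists N°; split; [exact: open_interior|exact: Nx|].
apply: (@smooth_nat_near _ _ _ _ _ (fun x => \sum_(i <- [seq i <- undup J | i \in D]) w i x)).
  move=> y Ny; have := open_nbhs_nbhs (conj (open_interior N) Ny).
  apply: filterS => z /interior_subset Nz; apply/esym/fsum_seq => i.
  exact: HJ.
by apply: smooth_sum => i; exact: smooth_nat_sub (@subsetT _ _) (sw i).
Qed.

(** The index set is split by [sh] into countably many levels, and near each
point at most one function of a given level is nonzero. *)
Definition sigma_discrete (sh : I -> nat) (w : I -> V -> R) :=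
  forall k (x : V), exists N : set V, nbhs x N /\
  forall y1 y2 i1 i2, N y1 -> N y2 -> sh i1 = k -> sh i2 = k -> w i1 y1 != 0 ->
    w i2 y2 != 0 -> i1 = i2.

Lemma sigma_discrete_finite sh w k (x : V) : sigma_discrete sh w -> exists N : set V, nbhs x N /\
  exists J : seq I, forall y i, N y -> (sh i < k)%N -> w i y != 0 -> i \in J.
Proof.
move=> sd; elim: k => [|k [N [Nx [J HJ]]]].
  by exists setT; split; [exact: filterT|exists [::]].
have [N' [N'x H']] := sd k x.
exists (N `&` N'); split; first exact: filterI.
have [[i0 [y0 [N'y0 si0 w0]]]|no] := pselect (exists i0 y0, [/\ N' y0, sh i0 = k & w i0 y0 != 0]).
  exists (i0 :: J) => y i [Ny N'y]; rewrite ltnS leq_eqVlt => /orP[/eqP sik wi|ik wi].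
    by rewrite inE (H' _ _ _ _ N'y N'y0 sik si0 wi w0) eqxx.
  by rewrite inE (HJ _ _ Ny ik wi) orbT.
exists J => y i [Ny N'y]; rewrite ltnS leq_eqVlt => /orP[/eqP sik wi|ik wi];
  last exact: HJ Ny ik wi.
by exfalso; apply: no; exists i, y.
Qed.

Lemma sigma_discrete_loc_finite sh w k : sigma_discrete sh w -> loc_finite [set i | sh i = k] w.
Proof.
move=> sd x; have [N [Nx [J HJ]]] := sigma_discrete_finite k.+1 x sd.
exists N; split => //; exists J => y i Ny /= sik; apply: HJ => //.
by rewrite sik.
Qed.

End LocallyFinite.

(** * Normalized bumps and maps into c0 *)

Section SmoothOn.
Context {R : realType}.

Definition le_order (n : nat) (m : option nat) := if m is Some k then (n <= k)%N else true.

Lemma smooth_onP (V W : normedModType R) m (U : set V) (f : V -> W) :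
  smooth_on m U f <-> forall n, le_order n m -> smooth_nat n U f.
Proof.
case: m => [k|] /=; last by split=> H n; [move=> _|]; exact: H.
split=> [H n nk|]; first exact: smooth_nat_le nk H.
by apply; exact: leqnn.
Qed.

(** Translate the bump so that it does not vanish at 0, then rescale. *)
Lemma normalized_bump (V : normedModType R) m : has_smooth_bump m V ->
  exists b : V -> R, [/\ b 0 = 1, forall x, 1 <= `|x| -> b x = 0 &
    smooth_on m setT b].
Proof.
move=> [b [[[x0 bx0] [B [[M [_ BM]] bB]]] sb]].
pose M' := `|M| + 1.
have HM x : B x -> `|x| <= M'.
  by move=> Bx; apply: BM Bx; rewrite /M'; apply: le_lt_trans (ler_norm M) _; rewrite ltrDl.
pose r := M' + `|x0| + 1.
have M0 : 0 <= M' by rewrite addr_ge0.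
have r0 : 0 < r by rewrite /r; have := normr_ge0 x0; lra.
exists (fun x => (b x0)^-1 * b (x0 + r *: x)); split.
- by rewrite scaler0 addr0 mulVf//; exact/eqP.
- move=> x x1; rewrite (bB (x0 + r *: x)) ?mulr0// => /HM; apply/negP; rewrite -ltNge.
  have := lerB_dist (r *: x) (- x0); rewrite opprK normrN normrZ (gtr0_norm r0) addrC.
  have : r <= r * `|x| by rewrite ler_peMr// ltW.
  by rewrite [r *: x + x0]addrC /r; lra.
- apply/smooth_onP => n nm; apply: smoothM; first exact: smooth_cst.
  apply: (@smooth_comp _ _ _ _ n _ setT (fun x => x0 + r *: x) b) => //.
    by have /smooth_onP := sb; exact.
  apply: smoothD; first exact: smooth_cst.
  by apply: smoothZ; [exact: smooth_cst|exact: smooth_id].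
Qed.

End SmoothOn.

Section C0Maps.
Context {R : realType} {V : normedModType R} {I : choiceType}.
Variables (sh : I -> nat) (w : I -> V -> R).
Hypothesis sd : sigma_discrete sh w.
Hypothesis cw : forall i, continuous (w i).
Hypothesis w_le : forall i x, `|w i x| <= 2^-1 ^+ sh i.

Lemma c0_uniform (x : V) (e : R) : 0 < e -> exists N : set V, nbhs x N /\ exists J : seq I,
  forall y i, N y -> i \notin J -> `|w i y| < e.
Proof.
move=> e0.
have [k Hk] : exists k : nat, 2^-1 ^+ k < e.
  have h : `|2^-1 : R| < 1 by rewrite ger0_norm ?invr_ge0// invf_lt1 ?ltr1n.
  have /cvgrPdist_lt /(_ e e0) [k _ Hk] := cvg_expr h.
  exists k; have := Hk k (leqnn k).
  by rewrite /= sub0r normrN ger0_norm// exprn_ge0// invr_ge0.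
have [N [Nx [J HJ]]] := sigma_discrete_finite k x sd.
exists N; split => //; exists J => y i Ny iJ.
have [ik|ki] := ltnP (sh i) k.
  have [->|wi] := eqVneq (w i y) 0; first by rewrite normr0.
  by move: iJ; rewrite (HJ _ _ Ny ik wi).
apply: le_lt_trans (w_le i y) _; apply: le_lt_trans Hk.
by apply: ler_wiXn2l => //; rewrite ?invr_ge0// invf_le1 ?ler1n.
Qed.

Lemma c0_map_in (x : V) : (fun i => w i x) \in @c0_pred R I.
Proof.
rewrite inE => e e0; have [N [Nx [J HJ]]] := c0_uniform x e0.
apply: (@sub_finite_set _ _ [set` J]) => // i /= ei.
apply: contraT => iJ; have := HJ _ _ (nbhs_singleton Nx) iJ.
by rewrite ltNge ei.
Qed.

Definition c0_map (x : V) : c0 R I := MkC0 (c0_map_in x).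

(** Near a given point, all coordinates are uniformly small except finitely
many: high levels because of the bounds, low levels because of discreteness. *)
Lemma c0_map_continuous : continuous c0_map.
Proof.
move=> x; apply/cvgrPdist_le => /= e e0.
have e2 : 0 < e / 2 by rewrite divr_gt0.
have [N [Nx [J HJ]]] := c0_uniform x e2.
have HN : \forall y \near x, forall i, i \in J -> `|w i x - w i y| <= e.
  elim: J {HJ} => [|i J IH]; first exact: nearW.
  near=> y => j; rewrite inE => /orP[/eqP ->|jJ]; last by move: j jJ; near: y; exact: IH.
  by near: y; have /cvgrPdist_le /(_ e e0) := @cw i x.
near=> y; rewrite c0_normE; apply: supnorm_le; first exact: ltW.
move=> i _; change (`|w i x - w i y| <= e).
have [iJ|iJ] := boolP (i \in J).
  by move: i iJ; near: y.
apply: le_trans (ler_normB _ _) _.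
have Ny : N y by near: y.
have := HJ _ _ (nbhs_singleton Nx) iJ; have := HJ _ _ Ny iJ; lra.
Unshelve. all: by end_near. Qed.

End C0Maps.

(** * From bumps to Talagrand operators *)

Section BumpToTalagrand.
Context {R : realType} {K : topologicalType} {cptK : compact [set: K]}.
Notation X := (Cfun R cptK).
Variable lt : K -> K -> Prop.
Hypothesis wf : well_founded lt.
Hypothesis tot : forall s t, [\/ lt s t, s = t | lt t s].
Hypothesis ltr : forall s t r, lt s t -> lt t r -> lt s r.
Hypothesis op : forall t, open [set s | lt s t \/ s = t].
Variable V : K -> set K.
Hypothesis VP : forall t, [/\ clopen (V t), V t t & forall s, V t s -> lt s t \/ s = t].
Variable bt : X -> R.
Hypothesis bt0 : 0 < bt 0.
Hypothesis bt_ge0 : forall f, 0 <= bt f.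
Hypothesis bt_le1 : forall f, bt f <= 1.
Hypothesis bt_out : forall f, 1 <= `|f| -> bt f = 0.

Let cV t : clopen (V t). Proof. by have [] := VP t. Qed.

Definition topmost (F : {fset K}) t := t \in F /\ forall s, s \in F -> lt s t \/ s = t.

Lemma topmost_uniq F s t : topmost F s -> topmost F t -> s = t.
Proof.
move=> [sF sm] [tF tm]; have [st|//] := tm _ sF; have [ts|//] := sm _ tF.
by exfalso; exact: (lt_irr wf (ltr st ts)).
Qed.

Definition tal_label := (rat * rat * {fset K})%type.

Definition tal_level (i : K * tal_label) := choice.pickle i.2.1.

Definition tal_coord (i : K * tal_label) (f : X) : R :=
  if pselect (topmost i.2.2 i.1) then
    2^-1 ^+ tal_level i * cover_weight bt V setT 0 i.2.1.1 i.2.1.2 i.2.2 f else 0.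

Lemma smooth_tal_coord n i : smooth_nat n setT bt -> smooth_nat n setT (tal_coord i).
Proof.
move=> sb; rewrite /tal_coord; case: pselect => [tp|ntp] /=; last exact: smooth_cst.
by apply: smoothM; [exact: smooth_cst|exact: smooth_cover_weight].
Qed.

Lemma tal_coord_le i f : `|tal_coord i f| <= 2^-1 ^+ tal_level i.
Proof.
rewrite /tal_coord; case: pselect => [tp|ntp] /=; last by rewrite normr0 exprn_ge0// invr_ge0.
have /andP[om0 om1] := @cover_weight01 R K cptK bt bt_ge0 bt_le1 V setT 0 i.2.1.1 i.2.1.2 i.2.2 f.
by rewrite ger0_norm ?mulr_ge0 ?exprn_ge0 ?invr_ge0// ler_piMr// exprn_ge0 ?invr_ge0.
Qed.

Lemma tal_coord_neq0 i f : tal_coord i f != 0 -> topmost i.2.2 i.1 /\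
  cover_weight bt V setT 0 i.2.1.1 i.2.1.2 i.2.2 f != 0.
Proof.
rewrite /tal_coord; case: pselect => [tp|ntp] /=; last by rewrite eqxx.
by move=> /eqP H; split => //; apply/eqP => E; apply: H; rewrite E mulr0.
Qed.

(** The antichain F determines its largest point, so an index (t, (q, q', F))
has no more freedom than F. *)
Lemma tal_coord_sigma_discrete : sigma_discrete tal_level tal_coord.
Proof.
move=> k f.
have [ [ [q q'] pk]|no] := pselect (exists p : rat * rat, choice.pickle p = k); last first.
  exists setT; split; first exact: filterT.
  by move=> f1 f2 i1 i2 _ _ s1; exfalso; apply: no; exists i1.2.1.
have [N [Nf HN]] := @cover_weight_uniq R K cptK bt bt_out V cV lt wf tot ltr VP
  setT 0 q q' f (clopen_full K).
exists N; split => // f1 f2 [t1 [p1 F1]] [t2 [p2 F2]] N1 N2.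
rewrite /tal_level /= => s1 s2 /tal_coord_neq0 /= [tp1 n1] /tal_coord_neq0 /= [tp2 n2].
have inj : injective (@choice.pickle (rat * rat : countType)%type).
  exact: pcan_inj choice.pickleK.
have E1 : p1 = (q, q') by apply: inj; rewrite s1.
have E2 : p2 = (q, q') by apply: inj; rewrite s2.
rewrite E1 in n1 *; rewrite E2 in n2 *.
have FE := HN _ _ _ _ N1 N2 n1 n2; rewrite FE in tp1 *.
by rewrite (topmost_uniq tp1 tp2).
Qed.

(** Let z be the largest of the points where f^2 is maximal.  Outside the open
initial segment that ends at z the maximum of f^2 is smaller, so for q close
enough to the maximum the set where f^2 >= q has largest point z, and its
canonical antichain contains z. *)
Lemma tal_coord_attains (f : X) : f <> 0 -> exists (t : K) (u : tal_label),
  `|f t| = `|f| /\ tal_coord (t, u) f <> 0.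
Proof.
move=> f0.
have K0 : [set: K] !=set0.
  by apply: contrapT => no; apply: f0; apply: cfunP => x; exfalso; apply: no; exists x.
pose h := sq_dev 0 f.
have ch : continuous h by exact: cfun_continuous.
have hE x : h x = `|f x| ^+ 2 by rewrite /h sq_devE subr0 real_normK// num_real.
have [|z1] := @compact_EVT_max K R (cfun_val h) setT K0 cptK; first exact: continuous_subspaceT.
move=> _ Hz1.
have z1max x : `|f x| <= `|f z1|.
  have := Hz1 x; rewrite inE => /(_ I); rewrite !hE ler_sqr ?nnegrE//.
have fz1 : `|f z1| = `|f|.
  by apply/eqP; rewrite eq_le cnorm_ub/=; apply: cnorm_le.
pose M := h z1.
have hM x : h x <= M by apply: Hz1; rewrite inE.
pose G0 := h @^-1` [set y | M <= y].
have cG0 : closed G0.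
  by apply: closed_comp; [move=> x _; exact: ch|exact: closed_ge].
have G0n : G0 !=set0 by exists z1; exact: lexx.
have [z [Gz zmax]] := closed_max tot ltr op cptK cG0 G0n.
pose O := [set s | lt s z \/ s = z].
have cO : closed (~` O) by apply: open_closedC; exact: op.
have [a aM aO] : exists2 a, a < M & forall x, ~ O x -> h x <= a.
  have [ O0|/set0P O0 ] := eqVneq (~` O) set0.
    exists (M - 1) => [|x nOx]; first by lra.
    by have : (~` O) x by []; rewrite O0.
  have cptO : compact (~` O) by exact: subclosed_compact cO cptK (@subsetT _ _).
  have [|c] := @compact_EVT_max K R (cfun_val h) (~` O) O0 cptO; first exact: continuous_subspaceT.
  rewrite inE => nOc Hc; exists (h c); last by move=> x nOx; apply: Hc; rewrite inE.
  rewrite ltNge; apply/negP => Mc; apply: nOc; exact: zmax.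
have [q [q' [aq qq' qM gap]]] := value_gap wf tot ltr op cptK ch aM.
pose G := h @^-1` [set y | ratr q <= y].
have cG : closed G by apply: closed_comp; [move=> x _; exact: ch|exact: closed_ge].
have GO s : G s -> lt s z \/ s = z.
  move=> Gs; apply: contrapT => /aO hs; have := le_lt_trans hs aq.
  by rewrite ltNge => /negP; apply.
have Gz' : G z by apply: le_trans Gz; apply: ltW; exact: lt_trans qM.
have [F [zF FG aF GF]] := canonical_cover wf tot ltr op cptK VP cG Gz' GO.
exists z, (q, q', F); split.
  apply/eqP; rewrite -fz1 eq_le z1max/=.
  by move: Gz; rewrite /G0 /= /M !hE ler_sqr ?nnegrE.
rewrite /tal_coord /=; case: pselect => [tp|ntp] /=; last first.
  by exfalso; apply: ntp; split => // s sF; exact/GO/FG.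
apply/eqP; rewrite gt_eqF// mulr_gt0 ?exprn_gt0 ?invr_gt0//.
have E0 : ratr 0 = 0 :> R by rewrite rmorph0.
apply: cover_weight_pos; [exact: bt0|exact: cV|exact: clopen_full| | | |].
- by split; [move: qq'; rewrite ltr_rat|exact: aF|].
- by move=> x; rewrite E0; exact: gap.
- by move=> s sF; rewrite E0; exact: FG.
- by move=> x _; rewrite E0 => qx; exact: GF.
Qed.

Lemma bump_talagrand m : smooth_on m setT bt -> has_talagrand_operator R m cptK.
Proof.
move=> sb; have /smooth_onP sb' := sb.
have cw i : continuous (tal_coord i).
  move=> f; have := @smooth_tal_coord 0 i; apply => //; apply: sb'; by case: (m).
exists tal_label, (c0_map tal_coord_sigma_discrete tal_coord_le); split.
- exact: c0_map_continuous.
- by move=> f f0; have [t [u [H1 H2]]] := tal_coord_attains f0; exists t, u.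
- move=> t u; apply/smooth_onP => n nm.
  by apply: smooth_nat_sub (@subsetT _ _) _; apply: smooth_tal_coord; exact: sb'.
Qed.

End BumpToTalagrand.

(** * From bumps to partitions of unity *)

Section BumpToPartitions.
Context {R : realType} {K : topologicalType} {cptK : compact [set: K]}.
Notation X := (Cfun R cptK).
Variable lt : K -> K -> Prop.
Hypothesis wf : well_founded lt.
Hypothesis tot : forall s t, [\/ lt s t, s = t | lt t s].
Hypothesis ltr : forall s t r, lt s t -> lt t r -> lt s r.
Hypothesis op : forall t, open [set s | lt s t \/ s = t].
Variable V : K -> set K.
Hypothesis VP : forall t, [/\ clopen (V t), V t t & forall s, V t s -> lt s t \/ s = t].
Variable bt : X -> R.
Hypothesis bt0 : 0 < bt 0.
Hypothesis bt_ge0 : forall f, 0 <= bt f.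
Hypothesis bt_le1 : forall f, bt f <= 1.
Hypothesis bt_out : forall f, 1 <= `|f| -> bt f = 0.

Let cV t : clopen (V t). Proof. by have [] := VP t. Qed.

(** One step of a program that cuts K into pieces.  The program works on a stack
of clopen sets.  A node (c, None) declares f to be about c on the top set and
removes it; a node (c, Some ((q, q'), (F, s))) splits the top set along V s,
where s is the largest point of the canonical antichain F of (f - c)^2 at the
levels q, q'. *)
Definition node := (rat * option (rat * rat * ({fset K} * K)))%type.
(** What remains of a node when the antichain and its largest point, the only
data that range over an uncountable set, are forgotten. *)
Definition node_shape := (rat * option (rat * rat))%type.
Definition shape_of (nd : node) : node_shape := (nd.1, omap fst nd.2).

Definition split_weight (W : set K) c (p : rat * rat) (u : {fset K} * K) (f : X) : R :=
  if pselect (topmost lt u.1 u.2) then cover_weight bt V W c p.1 p.2 u.1 f else 0.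

(** Nonzero if f passes all tests of the program l started on the stack st; leaves
are not tested here, since the final bump around [prog_value] takes care of
them. *)
Fixpoint prog_weight (st : seq (set K)) (l : seq node) (f : X) : R :=
  match l, st with
  | [::], [::] => 1
  | (c, None) :: l', W :: st' => prog_weight st' l' f
  | (c, Some (p, u)) :: l', W :: st' =>
      split_weight W c p u f * prog_weight (W `&` V u.2 :: W `\` V u.2 :: st') l' f
  | _, _ => 0
  end.

(** The step function that a program describes.  The set on top of the stack
takes precedence over those below it. *)
Fixpoint prog_value (st : seq (set K)) (l : seq node) : X :=
  match l, st with
  | (c, None) :: l', W :: st' =>
      cmul (ind_cfun W) (cst_cfun (ratr c)) + cmul (ind_cfun (~` W)) (prog_value st' l')
  | (c, Some (p, u)) :: l', W :: st' =>
      prog_value (W `&` V u.2 :: W `\` V u.2 :: st') l'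
  | _, _ => 0
  end.

Definition clopens (st : seq (set K)) := forall i, (i < size st)%N -> clopen (nth set0 st i).

Lemma clopens_cons W st : clopen W -> clopens st -> clopens (W :: st).
Proof. by move=> cW cst [|i] //=; rewrite ltnS; exact: cst. Qed.

Lemma clopens_inv W st : clopens (W :: st) -> clopen W /\ clopens st.
Proof. by move=> c; split; [exact: (c 0%N)|move=> i ist; exact: (c i.+1)]. Qed.

Lemma clopens_step W st s : clopens (W :: st) -> clopens (W `&` V s :: W `\` V s :: st).
Proof.
move=> /clopens_inv[cW cst]; apply: clopens_cons; first exact: clopen_setI.
by apply: clopens_cons => //; apply: clopen_setI => //; exact: clopen_compl.
Qed.

Lemma split_weight01 W c p u f : 0 <= split_weight W c p u f <= 1.
Proof.
rewrite /split_weight; case: pselect => [tp|ntp] /=; first exact: cover_weight01.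
by rewrite lexx ler01.
Qed.

Lemma prog_weight01 st l f : 0 <= prog_weight st l f <= 1.
Proof.
elim: l st => [|[c [[p u]|]] l IH] [|W st] //=; try by rewrite ?lexx ?ler01.
have /andP[a0 a1] := split_weight01 W c p u f.
have /andP[b0 b1] := IH (W `&` V u.2 :: W `\` V u.2 :: st).
by rewrite mulr_ge0//= mulr_ile1.
Qed.

Lemma smooth_prog_weight n st l : smooth_nat n setT bt -> smooth_nat n setT (prog_weight st l).
Proof.
move=> sb; elim: l st => [|[c [[p u]|]] l IH] [|W st] /=; try exact: smooth_cst.
  apply: smoothM => //; rewrite /split_weight; case: pselect => [tp|ntp] /=; last exact: smooth_cst.
  exact: smooth_cover_weight.
exact: IH.
Qed.

Lemma split_weight_neq0 W c p u f : split_weight W c p u f != 0 ->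
  topmost lt u.1 u.2 /\ cover_weight bt V W c p.1 p.2 u.1 f != 0.
Proof. by rewrite /split_weight; case: pselect => [tp|ntp] //=; rewrite eqxx. Qed.

Lemma mul_neq0 (a b : R) : a * b != 0 -> a != 0 /\ b != 0.
Proof. by rewrite mulf_eq0 negb_or => /andP. Qed.

(** The antichain of the first step is determined near f, hence also the stack
for the next step. *)
Lemma prog_weight_uniq (s : seq node_shape) st (f : X) : clopens st -> exists N : set X, nbhs f N /\
  forall f1 f2 l1 l2, N f1 -> N f2 -> map shape_of l1 = s -> map shape_of l2 = s ->
    prog_weight st l1 f1 != 0 -> prog_weight st l2 f2 != 0 -> l1 = l2.
Proof.
elim: s st => [|[c [p|]] s IH] st cst.
- exists setT; split; first exact: filterT.
  by move=> f1 f2 [|? ?] [|? ?].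
- case: st cst => [|W st] cst.
    exists setT; split; first exact: filterT.
    by move=> f1 f2 [|[c1 [[p1 u1]|]] l1] l2 _ _ //= _ _; rewrite eqxx.
  have [cW cst'] := clopens_inv cst.
  have [N1 [N1f H1]] := @cover_weight_uniq R K cptK bt bt_out V cV lt wf tot ltr VP
    W c p.1 p.2 f cW.
  have [[f0 [u0 [N1f0 w0]]]|no] :=
    pselect (exists f0 u0, N1 f0 /\ split_weight W c p u0 f0 != 0); last first.
    exists N1; split => // f1 f2 l1 l2 Nf1 _.
    case: l1 => [|[c1 [[p1 u1]|]] l1] //= [-> -> _] _ /mul_neq0[w1 _].
    by exfalso; apply: no; exists f1, u1.
  have [N2 [N2f H2]] := IH _ (@clopens_step W st u0.2 cst).
  exists (N1 `&` N2); split; first exact: filterI.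
  have key (f' : X) (u : {fset K} * K) : N1 f' -> split_weight W c p u f' != 0 -> u = u0.
    move=> N1f' /split_weight_neq0[tu wu]; have [tu0 wu0] := split_weight_neq0 w0.
    have E := H1 _ _ _ _ N1f' N1f0 wu wu0.
    move: u u0 tu tu0 E {wu wu0 w0 H2} => [F t] [F0 t0] /= tu tu0 E.
    by rewrite E in tu *; rewrite (topmost_uniq wf ltr tu tu0).
  move=> f1 f2 l1 l2 [Nf1 N2f1] [Nf2 N2f2].
  case: l1 => [|[c1 [[p1 u1]|]] l1] //= [-> -> s1].
  case: l2 => [|[c2 [[p2 u2]|]] l2] //= [-> -> s2].
  move=> /mul_neq0[w1 q1] /mul_neq0[w2 q2].
  rewrite (key _ _ Nf1 w1) in q1 *; rewrite (key _ _ Nf2 w2) in q2 *.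
  by rewrite (H2 _ _ _ _ N2f1 N2f2 s1 s2 q1 q2).
- case: st cst => [|W st] cst.
    exists setT; split; first exact: filterT.
    by move=> f1 f2 [|[c1 [[p1 u1]|]] l1] l2 _ _ //= _ _; rewrite eqxx.
  have [cW cst'] := clopens_inv cst.
  have [N [Nf H]] := IH _ cst'; exists N; split => // f1 f2 l1 l2 Nf1 Nf2.
  case: l1 => [|[c1 [[p1 u1]|]] l1] //= [-> s1].
  case: l2 => [|[c2 [[p2 u2]|]] l2] //= [-> s2].
  by move=> q1 q2; rewrite (H _ _ _ _ Nf1 Nf2 s1 s2 q1 q2).
Qed.

Definition approx (f : X) (e : R) st l := 0 < prog_weight st l f /\
  forall x i, (i < size st)%N -> nth set0 st i x -> `|prog_value st l x - f x| <= e.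

Lemma prog_value_leaf W st c l x : clopen W ->
  prog_value (W :: st) ((c, None) :: l) x = if x \in W then ratr c else prog_value st l x.
Proof.
move=> cW; transitivity ((cmul (ind_cfun W) (cst_cfun (ratr c)) : X) x +
    cmul (ind_cfun (~` W)) (prog_value st l) x).
  by [].
rewrite !cmulE !ind_cfunE//; last exact: clopen_compl.
rewrite cst_cfunE; have [Wx|nWx] := pselect (W x).
  by rewrite mem_set// memNset ?mul1r ?mul0r ?addr0.
by rewrite memNset// mul0r add0r mem_set// mul1r.
Qed.

Lemma approx_leaf f e W st l c : clopen W -> approx f e st l ->
  (forall x, W x -> `|ratr c - f x| <= e) -> approx f e (W :: st) ((c, None) :: l).
Proof.
move=> cW [w0 H] HW; split => // x i; rewrite prog_value_leaf//.
have [Wx _ _|nWx] := pselect (W x); first by rewrite mem_set//; exact: HW.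
by rewrite memNset//; case: i => [|i] //; rewrite ltnS; exact: H.
Qed.

Lemma approx_step f e W st l c p u : 0 < split_weight W c p u f ->
  approx f e (W `&` V u.2 :: W `\` V u.2 :: st) l ->
  approx f e (W :: st) ((c, Some (p, u)) :: l).
Proof.
move=> w0 [wl H]; split; first by rewrite /=; exact: mulr_gt0.
move=> x [|i] /= ist xi; last exact: (H x i.+2).
by have [Vx|nVx] := pselect (V u.2 x); [exact: (H x 0%N)|exact: (H x 1%N)].
Qed.

(** Induction on the largest point z of W.  Choose c close to f z and a gap q < q'
of (f - c)^2 between (e/2)^2 and e^2.  The set G where (f - c)^2 >= q does not
contain z.  Its largest point s splits W into a piece inside V s, which has a
largest point smaller than z, and the rest, for which G has become smaller; an
inner induction on G finishes with a piece on which f is within e of c. *)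
Lemma approx_exists f e : 0 < e -> forall W, closed W -> clopen W ->
  forall st l, approx f e st l -> exists l', approx f e (W :: st) l'.
Proof.
move=> e0; apply: (closed_ind wf) => W _ IHW cW st l al.
have [W0|/set0P Wn0] := eqVneq W set0.
  by exists ((0, None) :: l); apply: approx_leaf => // x; rewrite W0.
have [z [Wz zmax]] := closed_max tot ltr op cptK cW.2 Wn0.
have [c] : exists c : rat, `|f z - ratr c| < e / 2.
  have fe : f z - e / 2 < f z + e / 2 by lra.
  have [c] := rat_in_itvoo fe; rewrite in_itv /= => /andP[c1 c2]; exists c.
  by rewrite ltr_norml; apply/andP; split; lra.
move=> fzc.
pose h := sq_dev (ratr c) f.
have ch : continuous h by exact: cfun_continuous.
have hE x : h x = `|f x - ratr c| ^+ 2 by rewrite /h sq_devE real_normK// num_real.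
have ee : (e / 2) ^+ 2 < e ^+ 2 by rewrite ltr_sqr ?nnegrE; lra.
have [q [q' [eq_ qq' qe gap]]] := value_gap wf tot ltr op cptK ch ee.
have hz : h z < ratr q.
  by rewrite hE; apply: lt_trans eq_; rewrite ltr_sqr ?nnegrE//; lra.
have small x : h x < ratr q -> `|ratr c - f x| <= e.
  rewrite distrC => hx; have : `|f x - ratr c| ^+ 2 < e ^+ 2.
    by rewrite -hE; apply: lt_trans hx _; exact: lt_trans qe.
  by rewrite ltr_sqr ?nnegrE ?(ltW e0)//; exact: ltW.
(* the inner induction, on the part of the top set where f is not close to c *)
suff inner : forall G, closed G -> forall W', clopen W' -> W' `<=` W ->
    G = W' `&` [set x | ratr q <= h x] ->
    forall st l, approx f e st l -> exists l', approx f e (W' :: st) l'.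
  apply: (inner (W `&` [set x | ratr q <= h x]) _ W cW _ _ _ _ al) => //.
  apply: closedI; first by case: cW.
  apply: (@closed_comp _ _ h [set y | ratr q <= y]); last exact: closed_ge.
  by move=> x _; exact: ch.
apply: (closed_ind wf) => G cG IHG W' cW' W'W GE st1 l1 al1.
have [G0|/set0P Gn0] := eqVneq G set0.
  exists ((c, None) :: l1); apply: approx_leaf => // x W'x; apply: small.
  rewrite ltNge; apply/negP => qx; have : G x by rewrite GE.
  by rewrite G0.
have [s [Gs smax]] := closed_max tot ltr op cptK cG Gn0.
have W'q : W' s /\ ratr q <= h s by move: Gs; rewrite GE.
have [cVs Vss Vsl] := VP s.
have [l2 al2] : exists l2, approx f e (W' `\` V s :: st1) l2.
  apply: (IHG (G `\` V s)) al1 => //.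
  - by apply: closedI => //; exact: (clopen_compl cVs).2.
  - exists s => // t [Gt nVt]; have [//|ts] := smax _ Gt.
    by exfalso; apply: nVt; rewrite ts.
  - by apply: clopen_setI => //; exact: clopen_compl.
  - by move=> x [/W'W].
  - by rewrite GE; apply/seteqP; split => x; [move=> [[? ?] ?]|move=> [[? ?] ?]].
have [l3 al3] : exists l3, approx f e (W' `&` V s :: W' `\` V s :: st1) l3.
  have cI : clopen (W' `&` V s) by exact: clopen_setI.
  apply: (IHW (W' `&` V s)) al2 => //; first by case: cI.
  exists z => // t [_ Vt].
  have sz : lt s z.
    have [//|sz] := zmax _ (W'W _ W'q.1).
    by have := le_lt_trans W'q.2; rewrite sz => /(_ _ hz); rewrite ltxx.
  by have [ts|->//] := Vsl _ Vt; exact: ltr ts sz.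
have [F [sF FG aF GF]] := canonical_cover wf tot ltr op cptK VP cG Gs smax.
exists ((c, Some ((q, q'), (F, s))) :: l3); apply: approx_step => //.
rewrite /split_weight /=; case: pselect => [tp|ntp] /=; last first.
  by exfalso; apply: ntp; split => // t /FG /smax.
apply: cover_weight_pos; [exact: bt0|exact: cV|exact: cW'| |exact: gap| |].
- split; [by move: qq'; rewrite ltr_rat|exact: aF|].
  by move=> t /FG; rewrite GE => -[].
- by move=> t /FG; rewrite GE => -[].
- by move=> x W'x qx; apply: GF; rewrite GE.
Qed.

Section Cover.
Variable C : set (set X).
Hypothesis oC : open_cover C.

Definition pou_index := (nat * seq node)%type.
Definition pou_level (i : pou_index) : nat := choice.pickle (i.1, map shape_of i.2).

(** The closed ball that contains the support of the function with index i lies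
in a member of the cover. *)
Definition pou_admissible (i : pou_index) := exists2 U, C U &
  [set f : X | `|f - prog_value [:: setT] i.2| <= i.1.+1%:R^-1] `<=` U.

Definition pou_weight (i : pou_index) (f : X) : R :=
  if pselect (pou_admissible i) then
    prog_weight [:: setT] i.2 f * bt (i.1.+1%:R *: (f - prog_value [:: setT] i.2))
  else 0.

Lemma pou_weight01 i f : 0 <= pou_weight i f <= 1.
Proof.
rewrite /pou_weight; case: pselect => [ad|nad] /=; last by rewrite lexx ler01.
have /andP[a0 a1] := prog_weight01 [:: setT] i.2 f.
by rewrite mulr_ge0 ?bt_ge0//= mulr_ile1 ?bt_ge0 ?bt_le1.
Qed.

Lemma smooth_pou_weight n i : smooth_nat n setT bt -> smooth_nat n setT (pou_weight i).
Proof.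
move=> sb; rewrite /pou_weight; case: pselect => [ad|nad] /=; last exact: smooth_cst.
apply: smoothM; first exact: smooth_prog_weight.
apply: (@smooth_comp _ _ _ _ n _ setT
  (fun f => i.1.+1%:R *: (f - prog_value [:: setT] i.2)) bt) => //.
apply: smoothZ; first exact: smooth_cst.
by apply: smoothB; [exact: smooth_id|exact: smooth_cst].
Qed.

Lemma pou_weight_neq0 i f : pou_weight i f != 0 ->
  [/\ pou_admissible i, prog_weight [:: setT] i.2 f != 0 &
  `|f - prog_value [:: setT] i.2| <= i.1.+1%:R^-1].
Proof.
rewrite /pou_weight; case: pselect => [ad|nad] /=; last by rewrite eqxx.
move=> /mul_neq0[w1 w2]; split => //; rewrite leNgt; apply/negP => H.
move/eqP: w2; apply; apply: bt_out; rewrite normrZ normr_nat.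
by rewrite -ler_pdivrMl ?ltr0n// mulr1 ltW.
Qed.

Lemma clopens_top : clopens [:: [set: K]].
Proof. by apply: clopens_cons => //; exact: clopen_full. Qed.

Lemma pou_weight_sigma_discrete : sigma_discrete pou_level pou_weight.
Proof.
move=> k f.
have [[[n s] pk]|no] := pselect (exists p : nat * seq node_shape, choice.pickle p = k); last first.
  exists setT; split; first exact: filterT.
  by move=> f1 f2 i1 i2 _ _ s1; exfalso; apply: no; exists (i1.1, map shape_of i1.2).
have [N [Nf HN]] := prog_weight_uniq s f clopens_top.
exists N; split => // f1 f2 [n1 l1] [n2 l2] N1 N2.
have inj : injective (@choice.pickle (nat * seq node_shape : countType)%type).
  exact: pcan_inj choice.pickleK.
rewrite /pou_level /= -pk => /inj[-> s1] /inj[-> s2].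
move=> /pou_weight_neq0[_ /= w1 _] /pou_weight_neq0[_ /= w2 _].
by rewrite (HN _ _ _ _ N1 N2 s1 s2 w1 w2).
Qed.

(** Near 0 the bump is positive, and the ball around the step function is chosen
so small that it lies within the ball around f contained in a member of the
cover. *)
Lemma pou_weight_cover f : smooth_nat 0 setT bt -> exists i, 0 < pou_weight i f.
Proof.
move=> cb.
have [U CU Uf] : exists2 U, C U & U f.
  by have : [set: X] f by []; rewrite -(oC.2) => -[U CU Uf]; exists U.
have := open_nbhs_nbhs (conj (oC.1 _ CU) Uf) => /nbhs_ballP[d /= d0 dU].
have [eta eta0 Heta] : exists2 eta : R, 0 < eta & forall g : X, `|g| < eta -> 0 < bt g.
  have := cb 0 I => /cvgrPdist_lt /(_ _ bt0) /nbhs_ballP[eta /= eta0 Heta].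
  exists eta => // g geta; have : ball (0 : X) eta g by rewrite -ball_normE /= sub0r normrN.
  by move=> /Heta /=; rewrite ltr_norml => /andP[? ?]; lra.
pose k := Num.bound (2 / d).
have kd : 2 * k.+1%:R^-1 < d.
  rewrite ltr_pdivrMr ?ltr0n// mulrC -ltr_pdivrMr//.
  have h : 0 <= 2 / d by rewrite divr_ge0// ltW.
  by apply: lt_trans (archi_boundP h) _; rewrite ltr_nat.
have k0 : 0 < k.+1%:R^-1 :> R by rewrite invr_gt0 ltr0n.
pose e := Num.min (eta / 2) 1 * k.+1%:R^-1.
have e0 : 0 < e by rewrite mulr_gt0// lt_min ltr01 divr_gt0.
have [l [wl Hl]] : exists l, approx f e [:: setT] l.
  apply: (approx_exists e0 closedT (clopen_full K) (st := [::]) (l := [::])).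
  by split => //=; rewrite ltr01.
pose g := prog_value [:: setT] l.
have fg : `|f - g| <= e.
  apply: cnorm_le; first exact: ltW.
  by move=> x; rewrite cfunBE distrC; exact: (Hl x 0%N).
have ek : e <= k.+1%:R^-1 by rewrite ler_piMl ?(ltW k0)// ge_min lexx orbT.
exists (k, l); rewrite /pou_weight /=; case: pselect => [ad|nad] /=; last first.
  exfalso; apply: nad; exists U => // y /= yg; apply: dU.
  rewrite -ball_normE /=; apply: le_lt_trans kd.
  have -> : f - y = (f - g) - (y - g) by rewrite opprB addrA subrK.
  apply: le_trans (ler_normB _ _) _; rewrite -/g in yg.
  by rewrite mulr_natl mulr2n lerD// (le_trans fg).
apply: mulr_gt0 => //; apply: Heta; rewrite normrZ normr_nat -/g.
rewrite mulrC -ltr_pdivlMr ?ltr0n//; apply: le_lt_trans fg _.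
by rewrite /e ltr_pM2r// gt_min; apply/orP; left; lra.
Qed.

Definition level_sum (j : nat) (f : X) : R := \sum_(i \in [set i | pou_level i = j]) pou_weight i f.

Lemma level_sum_ge i f : pou_weight i f <= level_sum (pou_level i) f.
Proof.
have [N [Nf [J HJ]]] := sigma_discrete_loc_finite (pou_level i) pou_weight_sigma_discrete f.
apply: (fsum_ge_term (J := J)) => // [j|j]; first exact: HJ (nbhs_singleton Nf).
by have /andP[] := pou_weight01 j f.
Qed.

Lemma smooth_level_sum n j : smooth_nat n setT bt -> smooth_nat n setT (level_sum j).
Proof.
move=> sb; apply: smooth_fsum; first exact: sigma_discrete_loc_finite pou_weight_sigma_discrete.
by move=> i; exact: smooth_pou_weight.
Qed.

(** The first level that does not vanish at f is only multiplied by a positive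
number, since the earlier sums are 0 there; near f the factor of that level
kills all sufficiently late levels. *)
Definition loc_weight (i : pou_index) (f : X) : R :=
  pou_weight i f * \prod_(j <- iota 0 (pou_level i)) flat 0 (1 - (pou_level i)%:R * level_sum j f).

Lemma smooth_loc_weight n i : smooth_nat n setT bt -> smooth_nat n setT (loc_weight i).
Proof.
move=> sb; apply: smoothM; first exact: smooth_pou_weight.
apply: smooth_prod => j.
apply: (@smooth_comp _ _ _ _ n _ setT (fun f => 1 - _ * level_sum j f) (flat 0)) => //.
  exact: smooth_flat.
apply: smoothB; first exact: smooth_cst.
by apply: smoothM; [exact: smooth_cst|exact: smooth_level_sum].
Qed.

Lemma loc_weight_ge0 i f : 0 <= loc_weight i f.
Proof.
rewrite mulr_ge0//; first by have /andP[] := pou_weight01 i f.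
by apply: prodr_ge0 => j _; exact: flat_ge0.
Qed.

Lemma loc_weight_pou_weight i f : loc_weight i f != 0 -> pou_weight i f != 0.
Proof. by move=> /mul_neq0[]. Qed.

Lemma loc_weight_loc_finite : smooth_nat 0 setT bt -> loc_finite setT loc_weight.
Proof.
move=> cb f; have [i0 w0] := pou_weight_cover f cb.
pose c := level_sum (pou_level i0) f / 2.
have c0 : 0 < c by rewrite divr_gt0//; apply: lt_le_trans w0 _; exact: level_sum_ge.
have Hc : \forall g \near f, c < level_sum (pou_level i0) g.
  have := @smooth_level_sum 0 (pou_level i0) cb f I => /cvgrPdist_lt /(_ _ c0).
  by apply: filterS => g /=; rewrite /c ltr_norml => /andP[? ?]; lra.
pose k := (maxn (pou_level i0) (Num.bound c^-1)).+1.
have [N [Nf [J HJ]]] := sigma_discrete_finite k f pou_weight_sigma_discrete.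
exists (N `&` [set g | c < level_sum (pou_level i0) g]); split; first exact: filterI.
exists J => g i [Ng cg] _ wi; apply: HJ Ng _ (loc_weight_pou_weight wi).
rewrite ltnNge; apply/negP; rewrite /k gtn_max => /andP[i0i bi].
have [_ /eqP] := mul_neq0 wi; apply.
rewrite (big_rem (pou_level i0)) /=; last by rewrite mem_iota add0n.
rewrite flat_nonpos ?mul0r// subr_le0.
have ic : c^-1 < (pou_level i)%:R.
  have h : 0 <= c^-1 by rewrite invr_ge0 ltW.
  by apply: lt_trans (archi_boundP h) _; rewrite ltr_nat.
rewrite -ler_pdivrMr; last exact: lt_trans cg.
rewrite mul1r; apply/ltW; apply: lt_trans ic; rewrite ltf_pV2 ?posrE//.
exact: lt_trans cg.
Qed.

Lemma loc_weight_pos f : smooth_nat 0 setT bt -> exists i, 0 < loc_weight i f.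
Proof.
move=> cb.
(* the first level that does not vanish at f *)
have Ex : exists k, `[< exists2 i, pou_level i = k & 0 < pou_weight i f >].
  by have [i wi] := pou_weight_cover f cb; exists (pou_level i); apply/asboolP; exists i.
case: (ex_minnP Ex) => k /asboolP[i ik wi] kmin.
exists i; apply: mulr_gt0 => //; rewrite big_seq; apply: prodr_gt0 => j.
rewrite mem_iota add0n /= => ji; apply: flat_pos.
rewrite /level_sum fsbig1 ?mulr0 ?subr0 ?ltr01// => i' /= Ej.
apply/eqP; rewrite eq_le; have /andP[-> _] := pou_weight01 i' f; rewrite andbT leNgt.
apply/negP => w'; have : (k <= j)%N by apply: kmin; apply/asboolP; exists i'.
by rewrite leqNgt -ik ji.
Qed.

Definition total_weight (f : X) : R := \sum_(i \in [set: pou_index]) loc_weight i f.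

Lemma total_weight_gt0 f : smooth_nat 0 setT bt -> 0 < total_weight f.
Proof.
move=> cb; have [i wi] := loc_weight_pos f cb.
have [N [Nf [J HJ]]] := loc_weight_loc_finite cb f.
apply: lt_le_trans wi _; apply: (fsum_ge_term (J := J)) => // [j|j].
  exact: HJ (nbhs_singleton Nf).
exact: loc_weight_ge0.
Qed.

(** The quotient by the locally finite positive sum is smooth, and supports are
unchanged. *)
Lemma bump_partition m : smooth_on m setT bt ->
  exists (A : choiceType) (phi : A -> X -> R),
      [/\ locally_finite_partition_of_unity phi,
          subordinate phi C &
          forall a, smooth_on m [set: X] (phi a)].
Proof.
move=> sb; have /smooth_onP sb' := sb.
have cb : smooth_nat 0 setT bt by apply: sb'; case: (m).
exists pou_index, (fun i f => loc_weight i f * (total_weight f)^-1); split.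
- split.
  + by move=> i f; rewrite mulr_ge0 ?loc_weight_ge0// invr_ge0 ltW// total_weight_gt0.
  + move=> f; have [N [Nf [J HJ]]] := loc_weight_loc_finite cb f; exists N => //.
    apply: (@sub_finite_set _ _ [set` J]) => // i /= [g Ng /mul_neq0[wi _]].
    exact: HJ Ng I wi.
  + by move=> f; rewrite -mulr_fsuml mulfV// gt_eqF// total_weight_gt0.
- move=> i; have [ad|nad] := pselect (pou_admissible i).
    have [U CU HU] := ad; exists U => //; apply: subset_trans HU.
    set B := [set f : X | _ <= _].
    have cB : closed B.
      apply: (@closed_comp _ _ (fun f : X => `|f - prog_value [:: setT] i.2|)
        [set y | y <= i.1.+1%:R^-1]).
        move=> f _; apply: (@continuous_comp _ _ _
          (fun f : X => f - prog_value [:: setT] i.2) (@Num.norm R X)).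
          by apply: (@smoothB _ _ _ 0 setT) => //; [exact: smooth_id|exact: smooth_cst].
        exact: norm_continuous.
      exact: closed_le.
    rewrite (closure_id B).1//; apply: closure_subset => f /= /mul_neq0[/loc_weight_pou_weight].
    by move=> /pou_weight_neq0[].
  have [U CU U0] : exists2 U, C U & U 0.
    by have : [set: X] 0 by []; rewrite -(oC.2) => -[U CU Uf]; exists U.
  exists U => //; rewrite (_ : [set x | _] = set0) ?closure0// -subset0 => f /=.
  by move=> /mul_neq0[/loc_weight_pou_weight /pou_weight_neq0[]].
- move=> i; apply/smooth_onP => n nm; have sn := sb' n nm.
  apply: smoothM; first exact: smooth_loc_weight.
  apply: smoothV; first by move=> f _; rewrite gt_eqF// total_weight_gt0.
  by apply: smooth_fsum; [exact: loc_weight_loc_finite|move=> j; exact: smooth_loc_weight].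
Qed.

End Cover.
End BumpToPartitions.

(** * From partitions of unity and Talagrand operators to bumps *)

(** Among two open sets, a ball and a set without 0, the support of a function that
does not vanish at 0 can only lie in the ball. *)
Lemma partition_bump (R : realType) (X : normedModType R) m :
  has_smooth_partitions_of_unity m X -> has_smooth_bump m X.
Proof.
move=> pou.
pose Bi : set X := [set f | `|f| < 2]; pose Bo : set X := [set f | 1 < `|f|].
have oBi : open Bi.
  apply: (@open_comp _ _ (@Num.norm R X) [set y | y < 2]); last exact: open_lt.
  by move=> f _; exact: norm_continuous.
have oBo : open Bo.
  apply: (@open_comp _ _ (@Num.norm R X) [set y | 1 < y]); last exact: open_gt.
  by move=> f _; exact: norm_continuous.
have [|A [phi [[phi0 lf sum1] sub sm]]] := pou [set U | U = Bi \/ U = Bo].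
  split; first by move=> U [->|->].
  apply/seteqP; split => // f _; have [f2|f2] := ltP `|f| 2.
    by exists Bi => //; left.
  by exists Bo; [right|rewrite /Bo /=; lra].
have [a pa] : exists a, phi a 0 != 0.
  apply: contrapT => no; have := sum1 0; rewrite fsbig1 => [/eqP|a _].
    by rewrite eq_sym oner_eq0.
  by apply/eqP; apply: contraT => pa; exfalso; apply: no; exists a.
exists (phi a); split; last exact: sm.
split; first by exists 0; apply/eqP.
have [U [->|->] HU] := sub a; last first.
  by have := HU 0 (subset_closure (pa : [set x | phi a x != 0] 0)); rewrite /Bo /= normr0 ltr10.
exists Bi; split.
  exists 2; split => // M M2 f /= f2; exact/ltW/(lt_trans f2).
move=> f nBf; apply/eqP; apply: contraT => pf; exfalso; apply: nBf; apply: HU.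
exact: subset_closure.
Qed.

Section TalagrandToBump.
Context {R : realType} {K : topologicalType} {cptK : compact [set: K]}.
Notation X := (Cfun R cptK).
Variables (G : Type) (T : X -> c0 R (K * G)) (m : option nat).
Hypothesis tT : talagrand_operator m T.

Let I := {classic (K * G)}.
Let Ti (i : I) (f : X) : R := T f i.
Let pt (i : I) : K := (i : K * G).1.
Let kp : R := (`|T 0| ^+ 2 + 1)^-1.

Let c0_ub (x : c0 R (K * G)) i : `|x i| <= `|x|.
Proof. by rewrite c0_normE; exact: (supnorm_ub (c0_bounded x)). Qed.

Let kp0 : 0 < kp.
Proof. by rewrite invr_gt0 ltr_wpDl// sqr_ge0. Qed.

Let kpT0 i : kp * Ti i 0 ^+ 2 <= 1.
Proof.
rewrite mulrC ler_pdivrMr ?mul1r; last by rewrite ltr_wpDl// sqr_ge0.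
rewrite -real_normK ?num_real//; have := c0_ub (T 0) i => H.
by apply: (@le_trans _ _ (`|T 0| ^+ 2)); [rewrite ler_sqr ?nnegrE|rewrite lerDl].
Qed.

Let cTi i : continuous (Ti i).
Proof.
have [cT _ _] := tT; move=> f.
apply: (@continuous_comp _ _ _ T (fun x : c0 R (K * G) => x i)); first exact: cT.
by apply: (lip_continuous ltr01) => y; rewrite mul1r; exact: (c0_ub (T f - y) i).
Qed.

Definition tal_ratio (i : I) (f : X) : R := (1 - f (pt i) ^+ 2) * (kp * Ti i f ^+ 2)^-1.

(** Zero where the ratio is at least 1, and at least 1 where it is at most 1/2.
The condition on T is needed since division by 0 gives ratio 0. *)
Definition tal_term (i : I) (f : X) : R :=
  if Ti i f == 0 then 0 else flat 0 (1 - tal_ratio i f) * (flat 0 (2^-1))^-1.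

Let tal_term_ge0 i f : 0 <= tal_term i f.
Proof. by rewrite /tal_term; case: ifP => // _; rewrite mulr_ge0 ?invr_ge0 ?flat_ge0. Qed.

Let tal_term_neq0 i f : tal_term i f != 0 -> 1 - f (pt i) ^+ 2 < kp * Ti i f ^+ 2.
Proof.
rewrite /tal_term; case: ifPn => [_|Tn0]; first by rewrite eqxx.
move=> H; rewrite ltNge; apply/negP => le1; move/eqP: H; apply.
rewrite flat_nonpos ?mul0r// subr_le0 /tal_ratio ler_pdivlMr ?mul1r//.
by rewrite mulr_gt0// lt0r sqr_ge0 sqrf_eq0 Tn0.
Qed.

Let tal_term_ge1 i f : Ti i f != 0 ->
  1 - f (pt i) ^+ 2 <= kp * Ti i f ^+ 2 / 2 -> 1 <= tal_term i f.
Proof.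
move=> Tn0 H; rewrite /tal_term (negPf Tn0).
rewrite ler_pdivlMr ?flat_pos ?invr_gt0// mul1r; apply: flat0_mono.
have p0 : 0 < kp * Ti i f ^+ 2 by rewrite mulr_gt0// lt0r sqr_ge0 sqrf_eq0 Tn0.
have : tal_ratio i f <= 2^-1 by rewrite /tal_ratio ler_pdivrMr// mulrC.
lra.
Qed.

Let smooth_tal_term n i : le_order n m -> smooth_nat n [set f | Ti i f != 0] (tal_term i).
Proof.
move=> nm; set U := [set f | _].
have sT : smooth_nat n U (Ti i).
  have [_ _ sm] := tT; have /smooth_onP/(_ n nm) := sm (pt i) (i : K * G).2.
  rewrite (_ : [set f | _ ] = U) => [|].
    by rewrite /Ti; move: (i : K * G) => [t u].
  apply/seteqP; split => f /=; rewrite /U /Ti /pt /=; case: (i) => t u /=.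
    by move/eqP.
  by move/eqP.
have oU : open U.
  apply: (@open_comp _ _ (Ti i) [set y | y != 0]); first by move=> f _; exact: cTi.
  exact: open_neq.
apply: (@smooth_nat_near _ _ _ _ _ (fun f => flat 0 (1 - tal_ratio i f) * (flat 0 (2^-1))^-1)).
  move=> f Uf; have := open_nbhs_nbhs (conj oU Uf); apply: filterS => g Ug.
  by rewrite /tal_term (negPf Ug).
apply: smoothM; last exact: smooth_cst.
apply: (@smooth_comp _ _ _ _ n _ setT (fun f => 1 - tal_ratio i f) (flat 0)) => //.
  exact: smooth_flat.
have sq (g : X -> R) : smooth_nat n U g -> smooth_nat n U (fun f => g f ^+ 2).
  by move=> sg; apply: smooth_nat_eq (smoothM sg sg) _ => f; rewrite expr2.
apply: smoothB; first exact: smooth_cst.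
apply: smoothM.
  apply: smoothB; first exact: smooth_cst.
  by apply: sq; exact: smooth_eval.
apply: smoothV; last by apply: smoothM; [exact: smooth_cst|exact: sq].
by move=> f Uf; rewrite mulf_neq0 ?(gt_eqF kp0) ?sqrf_eq0// gt_eqF.
Qed.

(** For f in the open unit ball, 1 - g(t)^2 is bounded below for g near f, so a term
can only be nonzero if T(g)(t,u) is not small; in c0 this leaves finitely many
indices. *)
Let tal_term_finite (f : X) : `|f| < 1 -> exists N : set X, [/\ nbhs f N &
  exists J : seq I, (forall i, i \in J -> Ti i f != 0) /\
    forall g i, N g -> tal_term i g != 0 -> i \in J].
Proof.
move=> f1; have [cT _ _] := tT.
pose rh := (1 + `|f|) / 2.
have rh0 : 0 <= rh by rewrite /rh; have := normr_ge0 f; lra.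
have rh1 : rh < 1 by rewrite /rh; lra.
have frh : `|f| < rh by rewrite /rh; lra.
have c0 : 0 < 1 - rh ^+ 2 by rewrite subr_gt0 expr_lt1.
(* kp d^2 <= kp d <= 1 - rh^2, so a coordinate of size at most d gives a ratio at least 1 *)
pose d := Num.min 1 ((1 - rh ^+ 2) / kp).
have d0 : 0 < d by rewrite lt_min ltr01 divr_gt0.
have dk : kp * d ^+ 2 <= 1 - rh ^+ 2.
  have d1 : d <= 1 by rewrite ge_min lexx.
  have d2 : d <= (1 - rh ^+ 2) / kp by rewrite ge_min lexx orbT.
  rewrite mulrC -ler_pdivlMr//; apply: le_trans d2.
  by rewrite expr2 ler_piMl// ltW.
have [J0 J0E] : exists J : seq I, [set i | d / 2 <= `|T f i|] = [set` J].
  by apply/finite_seqP; apply: c0_finite; rewrite divr_gt0.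
have N1 : \forall g \near f, `|g| < rh.
  exact: (open_nbhs_nbhs (conj (@open_comp _ _ (@Num.norm R X) [set y | y < rh]
    (fun f _ => @norm_continuous _ _ f) (@open_lt _ _)) frh)).
have N2 : \forall g \near f, `|T f - T g| < d / 2.
  have /cvgrPdist_lt := cT f; apply; by rewrite divr_gt0.
exists [set g | `|g| < rh /\ `|T f - T g| < d / 2]; split.
  by near=> g; split; near: g.
exists J0; split.
  move=> i iJ; have : [set` J0] i by [].
  rewrite -J0E /= => H; rewrite -normr_gt0; apply: lt_le_trans H.
  by rewrite divr_gt0.
move=> g i [g1 gT] /tal_term_neq0 H; suff : [set` J0] i by [].
rewrite -J0E /=.
have gi : g (pt i) ^+ 2 <= rh ^+ 2.
  rewrite -real_normK ?num_real// ler_sqr ?nnegrE//.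
  by apply: le_trans (cnorm_ub g _) _; exact: ltW.
have Tg : d < `|T g i|.
  rewrite ltNge; apply/negP => Td.
  have : kp * Ti i g ^+ 2 <= kp * d ^+ 2.
    by rewrite ler_pM2l// /Ti -real_normK ?num_real// ler_sqr ?nnegrE// ltW.
  by lra.
have := lerB_dist (T g i) (T f i); rewrite distrC.
have : `|T f i - T g i| <= `|T f - T g| by exact: (c0_ub (T f - T g) i).
lra.
Unshelve. all: by end_near. Qed.

Definition tal_bump (f : X) : R :=
  if `|f| < 1 then flat 0 (1 - \sum_(i \in [set: I]) tal_term i f) else 0.

(** If the norm of f is at least 1, the index (t,u) provided by the operator has
f(t)^2 >= 1 and T(f)(t,u) nonzero.  The ratio is at most 0 at f and remains below
1/2 nearby, so this single term makes the sum at least 1. *)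
Lemma tal_bump_out (f : X) : 1 <= `|f| -> \forall g \near f, tal_bump g = 0.
Proof.
move=> f1; have f0 : f <> 0 by move=> E; move: f1; rewrite E normr0 ler10.
have [_ att _] := tT.
have [t [u [ft Tn0]]] := att f f0.
pose i : I := (t, u).
have Ti0 : Ti i f != 0 by exact/eqP.
have oN : open [set g : X | Ti i g != 0].
  apply: (@open_comp _ _ (Ti i) [set y | y != 0]); first by move=> g _; exact: cTi.
  exact: open_neq.
pose D (g : X) := kp * Ti i g ^+ 2 / 2 - (1 - g t ^+ 2).
have sD : smooth_nat 0 setT D.
  have sq (h : X -> R) : smooth_nat 0 setT h -> smooth_nat 0 setT (fun f => h f ^+ 2).
    by move=> sh; apply: smooth_nat_eq (smoothM sh sh) _ => g; rewrite expr2.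
  have sT : smooth_nat 0 setT (Ti i) by move=> g _; exact: cTi.
  apply: smoothB.
    apply: smoothM; last exact: smooth_cst.
    by apply: smoothM; [exact: smooth_cst|exact: sq].
  by apply: smoothB; [exact: smooth_cst|apply: sq; exact: smooth_eval].
have D0 : 0 < D f.
  have p0 : 0 < kp * Ti i f ^+ 2 by rewrite mulr_gt0// lt0r sqr_ge0 sqrf_eq0 Ti0.
  have : 1 <= f t ^+ 2 by rewrite -real_normK ?num_real// ft expr_ge1.
  by rewrite /D; lra.
have oD : open [set g | 0 < D g].
  apply: (@open_comp _ _ D [set y | 0 < y]); last exact: open_gt.
  by move=> g _; exact: sD.
have N1 := open_nbhs_nbhs (conj oN Ti0); have N2 := open_nbhs_nbhs (conj oD D0).
near=> g; rewrite /tal_bump; case: ifPn => // g1.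
have Tg : Ti i g != 0 by near: g.
have Dg : 0 < D g by near: g.
have w1 : 1 <= tal_term i g by apply: tal_term_ge1 => //; move: Dg; rewrite /D /pt /=; lra.
have [N [Ng [J [_ HJ]]]] := tal_term_finite g1.
rewrite flat_nonpos// subr_le0; apply: le_trans w1 _.
apply: (fsum_ge_term (J := J)) => // j _; exact: HJ (nbhs_singleton Ng).
Unshelve. all: by end_near. Qed.

Lemma smooth_tal_bump n : le_order n m -> smooth_nat n setT tal_bump.
Proof.
move=> nm; apply: smooth_nat_local => f _.
have [f1|f1] := ltP `|f| 1; last first.
  exists [set g | tal_bump g = 0]°; split; [exact: open_interior|exact: tal_bump_out|].
  apply: (@smooth_nat_near _ _ _ _ _ (fun=> 0)); last exact: smooth_cst.
  move=> g Og; have := open_nbhs_nbhs (conj (open_interior _) Og).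
  by apply: filterS => h /interior_subset /= ->.
have [N [Nf [J [TJ HJ]]]] := tal_term_finite f1.
pose O := [set g : X | `|g| < 1] `&` N° `&` [set g | forall i, i \in J -> Ti i g != 0].
have oB : open [set g : X | `|g| < 1].
  apply: (@open_comp _ _ (@Num.norm R X) [set y | y < 1]); last exact: open_lt.
  by move=> g _; exact: norm_continuous.
have oT : open [set g : X | forall i, i \in J -> Ti i g != 0].
  rewrite (_ : [set g | _] = \big[setI/setT]_(i <- J) [set g | Ti i g != 0]).
    apply: big_ind; [exact: openT|exact: openI|move=> i _].
    apply: (@open_comp _ _ (Ti i) [set y | y != 0]); first by move=> g _; exact: cTi.
    exact: open_neq.
  by rewrite -bigcap_seq; apply/seteqP; split.
have oO : open O by apply: openI => //; apply: openI => //; exact: open_interior.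
exists O; split => //.
apply: (@smooth_nat_near _ _ _ _ _
  (fun g => flat 0 (1 - \sum_(i <- [seq i <- undup J | i \in [set: I]]) tal_term i g))).
  move=> g Og; have := open_nbhs_nbhs (conj oO Og); apply: filterS => h [[h1 Nh] _].
  rewrite /tal_bump; rewrite (h1 : `|h| < 1); congr (flat 0 (1 - _)).
  apply/esym/fsum_seq => i _; exact: HJ (interior_subset Nh).
apply: (@smooth_comp _ _ _ _ n _ setT
  (fun g => 1 - \sum_(i <- [seq i <- undup J | i \in [set: I]]) tal_term i g) (flat 0)) => //.
  exact: smooth_flat.
apply: smoothB; first exact: smooth_cst.
have sJ : forall s : seq I, {subset s <= J} -> smooth_nat n O (fun g => \sum_(i <- s) tal_term i g).
  elim=> [_|i s IH sJ].
    by apply: (smooth_nat_eq (smooth_cst n O (0 : R))) => g; rewrite big_nil.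
  have H1 : smooth_nat n O (tal_term i).
    apply: smooth_nat_sub (smooth_tal_term i nm) => g [_ H]; apply: H; apply: sJ.
    by rewrite inE eqxx.
  have H2 : smooth_nat n O (fun g => \sum_(i <- s) tal_term i g).
    by apply: IH => j js; apply: sJ; rewrite inE js orbT.
  by apply: (smooth_nat_eq (smoothD H1 H2)) => g; rewrite big_cons.
by apply: sJ => i; rewrite mem_filter mem_undup => /andP[].
Qed.

Lemma tal_bump0 : tal_bump 0 != 0.
Proof.
rewrite /tal_bump normr0 ltr01 fsbig1 ?subr0; first by rewrite gt_eqF// flat_pos.
move=> i _; apply/eqP; apply: contraT => /tal_term_neq0.
by rewrite cfun0E expr0n /= subr0 ltNge kpT0.
Qed.

Lemma talagrand_bump : has_smooth_bump m X.
Proof.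
exists tal_bump; split; last by apply/smooth_onP => n nm; exact: smooth_tal_bump.
split; first by exists 0; apply/eqP; exact: tal_bump0.
exists [set f | `|f| < 1]; split.
  by exists 1; split => // M M1 f /= f1; exact/ltW/(lt_trans f1).
by move=> f /= /negP nf; rewrite /tal_bump (negPf nf).
Qed.

End TalagrandToBump.

Lemma bump_talagrand_partitions (R : realType) (K : topologicalType)
    (cptK : compact [set: K]) (hausK : hausdorff_space K)
    (m : option nat) (m_gt0 : m <> Some 0%N) :
  has_smooth_bump m (Cfun R cptK) ->
  has_talagrand_operator R m cptK /\ has_smooth_partitions_of_unity m (Cfun R cptK).
Proof.
move=> /normalized_bump[b [b0 bout sb]].
have /smooth_onP sb' := sb.
have sK : @scattered K.
  apply: (bump_scattered hausK b0 bout); apply: sb'.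
  by case: (m) m_gt0 => [[|k]|].
have [lt [wf tot ltr op]] := scattered_order sK.
have [V VP] := clopen_system wf op cptK hausK.
pose bt f := flat 0 (b f * b f).
have bt0 : 0 < bt 0 by rewrite /bt b0 mulr1 flat_pos.
have bt_ge0 f : 0 <= bt f by exact: flat_ge0.
have bt_le1 f : bt f <= 1 by exact: flat0_le1.
have bt_out f : 1 <= `|f| -> bt f = 0.
  by move=> f1; rewrite /bt bout// mulr0 flat_nonpos.
have sbt : smooth_on m setT bt.
  apply/smooth_onP => n nm.
  apply: (@smooth_comp _ _ _ _ n _ setT (fun f => b f * b f) (flat 0)) => //.
    exact: smooth_flat.
  by apply: smoothM; exact: sb'.
split; first exact: (bump_talagrand wf tot ltr op VP bt0 bt_ge0 bt_le1 bt_out sbt).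
by move=> C oC; exact: (bump_partition wf tot ltr op VP bt0 bt_ge0 bt_le1 bt_out oC sbt).
Qed.

Theorem theorem1 (R : realType) (K : topologicalType)
    (cptK : compact [set: K]) (hausK : hausdorff_space K)
    (m : option nat) (m_gt0 : m <> Some 0%N) :
  (has_smooth_bump m (Cfun R cptK) <-> has_talagrand_operator R m cptK) /\
  (has_talagrand_operator R m cptK <->
   has_smooth_partitions_of_unity m (Cfun R cptK)).
Proof.
have TB : has_talagrand_operator R m cptK -> has_smooth_bump m (Cfun R cptK).
  by move=> [G [T tT]]; exact: talagrand_bump tT.
have BTP := bump_talagrand_partitions hausK m_gt0.
split; split.
- by move=> /BTP[].
- exact: TB.
- by move=> /TB /BTP[].
- by move=> /partition_bump /BTP[].
Qed.
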